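(* For any randomized algorithm $\mathsf A$ (in the incremental higher-order oracle model), any $p\in\mathbb N$, $\Delta$, $L_p$, $\varepsilon$, and any $n$ with $$n\le c_p\,\Delta^{\frac{2p}{p+1}}L_p^{\frac{2}{p+1}}\varepsilon^{-2},$$ there exist a dimension $$d\le\tilde{\mathcal O}\left(n^{\frac{2p-1}{p}}\Delta L_p^{2/p}\varepsilon^{-\frac{2(p+1)}{p}}\right)\le\tilde{\mathcal O}\left(n^2\Delta L_p^2\varepsilon^{-4}\right)$$ and a function $F\in\mathcal F_p^n(\Delta,L_p)$ (with domain $\mathbb R^d$) such that $$T_\varepsilon(\mathsf A,F)\ \ge\ \Omega\left(\left(\frac{L_p}{\hat\ell_p}\right)^{\frac1p}\frac{\Delta\,n^{\frac{p-1}{2p}}}{\varepsilon^{\frac{p+1}{p}}}\right),$$ where $\hat\ell_p$ is a quantity depending only on $p$ with $\hat\ell_p\le\exp(cp\log p+c)$ for some constant $c<\infty$. For fixed $p$, $c_p$ is also a universal constant.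
   Context: Here $n,p\ge1$ are integers and $\Delta,L_p,\varepsilon>0$. Throughout, $\|\cdot\|$ is the tensor operator norm (Euclidean norm for vectors, spectral norm for matrices). Function class. $F\in\mathcal F_p^n(\Delta,L_p)$ if for some $d$, $F:\mathbb R^d\to\mathbb R$, $F(\mathbf x)=\frac1n\sum_{i=1}^n f_i(\mathbf x)$ (the components $f_i$ being part of the data), where (i) each $f_i$ is $p$ times continuously differentiable and $\|\nabla^p f_i(\mathbf x)-\nabla^p f_i(\mathbf y)\|\le L_p\|\mathbf x-\mathbf y\|$ for all $\mathbf x,\mathbf y$; and (ii) $F(\mathbf 0)-\inf_{\mathbf x}F(\mathbf x)\le\Delta$. Oracle and algorithms (incremental higher-order oracle model). For an arbitrary order $q$, the oracle for $F$ maps $(i,\mathbf x)\in[n]\times\mathbb R^d$ to $\nabla^{(0:q)}f_i(\mathbf x)$, the collection of the value and all derivative tensors of $f_i$ at $\mathbf x$ of orders up to $q$ (the oracle is considered for functions for which these derivatives exist). An algorithm $\mathsf A$ has access to an infinite sequence of random bits $\xi\sim\mathcal U([0,1])$ drawn at the beginning and consists of a sequence of mappings $A^{(t)}$, $t\in\mathbb N$, producing indices $i^t\in[n]$ and iterates $\mathbf x^{(t)}\in\mathbb R^d$ from previous oracle responses: $$[i^t,\mathbf x^{(t)}]=A^{(t)}\{\xi,\,i^{0:t-1},\,\mathbf x^{(0:t-1)},\,\nabla^{(0:q)}f_{i^0}(\mathbf x^{(0)}),\dots,\nabla^{(0:q)}f_{i^{t-1}}(\mathbf x^{(t-1)})\},$$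 with $\mathbf x^{(0)}=\mathbf 0$ and no restriction on how $i^0$ is chosen. An algorithm can be run on functions of any dimension $d$. Complexity. $T_\varepsilon(\mathsf A,F)$ is the infimum over all $t\in\mathbb N$ such that the event ''$\|\nabla F(\mathbf x^{(s)})\|>\varepsilon$ for all $s\le t$'' has probability at most $\frac12$, where $\mathbf x^{(s)}$ are the iterates of $\mathsf A$ run on $F$ (probability over $\xi$). Notation. $\Omega$ hides constant factors; $\tilde{\mathcal O}$ hides, in addition to constants, polylogarithmic factors in $d$, $n$ and $1/\varepsilon$.
   Formalization: The constant in the two Õ dimension bounds is universal only when ε ≤ L_p and ε^{p+1} ≤ L_p (so for all small ε); for other ε it may depend on p, Δ, L_p, since uniform constants fail (n = ε = 1, ΔL_p^{1/p} fixed large, L_p → 0 forces d = 0). *)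

(* Defs.v *)
From HB Require Import structures.
From mathcomp Require Export all_boot all_order all_algebra.
From mathcomp Require Export all_classical all_reals all_analysis.

Set Implicit Arguments.
Unset Strict Implicit.
Unset Printing Implicit Defensive.

Export Order.TTheory GRing.Theory Num.Theory.
Export numFieldNormedType.Exports.

Local Open Scope classical_set_scope.
Local Open Scope ring_scope.

(* Measurable structures on matrices and on finite families, generated by the
   coordinates as in the library's structure on n.-tuple T.  For T = R these are
   the Borel sigma-algebras. *)

Definition g_sigma_coord d (T : sigmaRingType d) (S I : Type) (f : I -> S -> T) :
    set (set S) :=
  <<s \bigcup_i preimage_set_system setT (f i) measurable >>.

Section measurable_matrix.
Context {d : measure_display} {T : sigmaRingType d}.
Variables m n : nat.

Let coord (ij : 'I_m * 'I_n) (M : 'M[T]_(m, n)) : T := M ij.1 ij.2.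

Let matrix_set0 : g_sigma_coord coord set0.
Proof. exact: sigma_algebra0. Qed.

Let matrix_setC (A : set 'M[T]_(m, n)) : g_sigma_coord coord A -> g_sigma_coord coord (~` A).
Proof. exact: sigma_algebraC. Qed.

Let matrix_bigcup (F : (set 'M[T]_(m, n))^nat) :
  (forall i, g_sigma_coord coord (F i)) -> g_sigma_coord coord (\bigcup_i F i).
Proof. exact: sigma_algebra_bigcup. Qed.

HB.instance Definition _ := @isMeasurable.Build (measure_tuple_display d)
  'M[T]_(m, n) (g_sigma_coord coord) matrix_set0 matrix_setC matrix_bigcup.

End measurable_matrix.

Section measurable_ffun.
Context {d : measure_display} {T : sigmaRingType d}.
Variable I : finType.

HB.instance Definition _ := isPointed.Build {ffun I -> T} [ffun=> point].

Let coord (i : I) (g : {ffun I -> T}) : T := g i.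

Let ffun_set0 : g_sigma_coord coord set0.
Proof. exact: sigma_algebra0. Qed.

Let ffun_setC (A : set {ffun I -> T}) : g_sigma_coord coord A -> g_sigma_coord coord (~` A).
Proof. exact: sigma_algebraC. Qed.

Let ffun_bigcup (F : (set {ffun I -> T})^nat) :
  (forall i, g_sigma_coord coord (F i)) -> g_sigma_coord coord (\bigcup_i F i).
Proof. exact: sigma_algebra_bigcup. Qed.

HB.instance Definition _ := @isMeasurable.Build (measure_tuple_display d)
  {ffun I -> T} (g_sigma_coord coord) ffun_set0 ffun_setC ffun_bigcup.

End measurable_ffun.

Section smooth_functions.
Context {R : realType}.

(* The norm `|x| of the library on row vectors is the sup norm. *)
Definition enorm d (x : 'rV[R]_d) : R := Num.sqrt (\sum_(j < d) x 0 j ^+ 2).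

(* pderiv f [:: i1; ...; ik] is the iterated partial derivative
   d_(i1) ... d_(ik) f. *)
Fixpoint pderiv d (f : 'rV[R]_d -> R) (s : seq 'I_d) : 'rV[R]_d -> R :=
  if s is i :: s' then fun x => 'D_(delta_mx 0 i) (pderiv f s') x else f.

(* A function is k times (Frechet) differentiable iff all its iterated partial
   derivatives of order less than k are differentiable. *)
Definition times_differentiable (k d : nat) (f : 'rV[R]_d -> R) : Prop :=
  forall (s : seq 'I_d) (x : 'rV[R]_d),
    (size s < k)%N -> differentiable (pderiv f s) x.

Definition times_continuously_differentiable (k d : nat) (f : 'rV[R]_d -> R) :
    Prop :=
  times_differentiable k f /\
  forall s : seq 'I_d, size s = k -> continuous (pderiv f s).

Definition gradient d (f : 'rV[R]_d -> R) (x : 'rV[R]_d) : 'rV[R]_d :=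
  \row_j pderiv f [:: j] x.

(* Order-k tensors are given by their d ^ k coordinates. *)
Definition deriv_tensor (k d : nat) (f : 'rV[R]_d -> R) (x : 'rV[R]_d) :
    {ffun k.-tuple 'I_d -> R} :=
  [ffun s : k.-tuple 'I_d => pderiv f s x].

Definition contract (k d : nat) (T : {ffun k.-tuple 'I_d -> R})
    (v : 'I_k -> 'rV[R]_d) : R :=
  \sum_(s : k.-tuple 'I_d) T s * \prod_(j < k) v j 0 (tnth s j).

Definition opnorm (k d : nat) (T : {ffun k.-tuple 'I_d -> R}) : R :=
  sup [set `|contract T v| | v in [set v : 'I_k -> 'rV[R]_d |
                                     forall j, enorm (v j) <= 1]].

Definition average (n d : nat) (f : 'I_n -> 'rV[R]_d -> R) (x : 'rV[R]_d) : R :=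
  n%:R^-1 * \sum_(i < n) f i x.

(* The infimum is taken in \bar R, so the last clause forces the average to be
   bounded below. *)
Definition finite_sum_class (p n : nat) (Delta L : R) (d : nat)
    (f : 'I_n -> 'rV[R]_d -> R) : Prop :=
  [/\ forall i, times_continuously_differentiable p (f i),
      forall i x y, opnorm (deriv_tensor p (f i) x - deriv_tensor p (f i) y)
                      <= L * enorm (x - y)
    & ((average f 0)%:E - ereal_inf (range (fun x => (average f x)%:E))
        <= Delta%:E)%E].

End smooth_functions.

Section incremental_oracle.
Context {R : realType}.

(* An oracle response of order q lists all partial derivatives of order at most q;
   they are indexed by q.-bseq 'I_d, the sequences of length at most q, and the
   empty sequence gives the function value. *)
Definition response (q d : nat) : Type := {ffun q.-bseq 'I_d -> R}.

Definition oracle (q n d : nat) (f : 'I_n -> 'rV[R]_d -> R) (i : 'I_n)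
    (x : 'rV[R]_d) : response q d :=
  [ffun s : q.-bseq 'I_d => pderiv (f i) s x].

(* One entry per past query: index, point and response.  Indices are recorded as
   natural numbers because nat carries a measurable structure and 'I_n does not
   (measurable types are nonempty). *)
Definition history (q d t : nat) : Type :=
  t.-tuple (nat * 'rV[R]_d * response q d).

(* The random input is a real number, later drawn uniformly in [0, 1]. *)
Record algorithm (n q : nat) := Algorithm {
  step : forall d t : nat, R * history q d t -> 'I_n * 'rV[R]_d ;
  measurable_step : forall d t,
    measurable_fun setT
      (fun h : R * history q d t => ((step h).1 : nat, (step h).2)) ;
  step0 : forall d (h : R * history q d 0), (step h).2 = 0 }.

Variables (n q : nat) (A : algorithm n q) (d : nat) (f : 'I_n -> 'rV[R]_d -> R).

Fixpoint run (xi : R) (t : nat) : history q d t :=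
  if t is t'.+1 then
    let ix := step A (xi, run xi t') in
    [tuple of rcons (run xi t') (ix.1 : nat, ix.2, oracle q f ix.1 ix.2)]
  else [tuple].

Definition iterate (xi : R) (t : nat) : 'rV[R]_d := (step A (xi, run xi t)).2.

Definition complexity (eps : R) : \bar R :=
  ereal_inf [set t%:R%:E | t in [set t : nat |
    (uniform_prob (@ltr01 R)
       [set xi : R | forall s, (s <= t)%N ->
                       (eps < enorm (gradient (average f) (iterate xi s)))%R]
     <= (2^-1)%:E)%E]].

End incremental_oracle.

Arguments algorithm : clear implicits.

(* X, multiplied by C and by a power of 1 + log (1 + d) + log (1 + n)
   + log (1 + 1 / eps): a bound of the form \tilde O(X). *)
Definition softO {R : realType} (C : R) (k d n : nat) (eps X : R) : R :=
  C * (1 + ln (1 + d%:R) + ln (1 + n%:R) + ln (1 + eps^-1)) ^+ k * X.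

(* Main.v *)
Require Import Defs.
From mathcomp Require Import all_boot all_order all_algebra.
From mathcomp Require Import all_classical all_reals all_analysis.
From mathcomp Require Import measurable_realfun ring lra zify.

(** The hard functions are chains. Split the coordinates into blocks [(i, j)] of
    size [m], with [i] in ['I_n] and [j < K], and hide in each block a unit vector
    [u_ij] with entries [+- m ^ (- 1/2)]. In the rescaled variable [y = r x], with
    blocks [y_j], component [i] is [alpha] times the sum over [j < K] of
      [|y_j|^2 / 2 - gate (y_(j-1)) * ridge (<u_ij, y_j>)],
    where the gate vanishes identically at distance at least [1/2] from
    [u_i(j-1)] and equals [1] close to it, and the ridge has slope [1] on
    [[-1, 2]]. Four facts give the theorem.

    Information ([dirder_chain_hidden]). As long as two consecutive gates are
    closed, no derivative seen by the oracle depends on the hidden vector in between, so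
    a query to component [i] reveals at most one new vector of that component,
    unless the point falls by accident near a vector that is not yet revealed.
    For uniformly random signs a fixed point does so with probability at most
    [2 ^ - (m / 8)] ([card_near]), and a union bound over the queries and the
    blocks controls all accidents as soon as [m] is a large multiple of
    [log (n K)] ([card_not_clean]). Since the random input of the algorithm is
    independent of the signs, the signs can be counted for each value of the input;
    averaging over the input then yields one choice of signs that resists with
    probability more than [1/2] ([exists_likely_event]). Only sign patterns are
    randomized, so that all counting takes place in a finite set.

    Gradient ([chain_descent], [gradient_clean]). In the first block of component
    [i] that is not close to its hidden vector, the gate is open and the block
    behaves like [|y_j - u_ij|^2 / 2], so the gradient restricted to that block has
    norm at least [1/4]. Before [n K / 2] queries at least [n / 2] components have
    an unrevealed block; these contributions are orthogonal, and the gradient of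
    the average exceeds a constant times [alpha r / sqrt n].

    Smoothness ([dirder_chain_bound]). Each link depends on two consecutive blocks
    only, hence two of the [p + 1 >= 2] directions of differentiation absorb the sum
    over [j] by Cauchy-Schwarz: the Lipschitz constant of the [p]-th derivative is
    at most [lhat p = exp (a p log p + a)], whatever [K] and the dimension
    ([chain_bound_growth]). The factor [p log p] comes from the step function,
    an iterated box average with windows of summable widths [1 / k^2].

    Scaling. Prescribing [alpha r = 8 eps sqrt n] and
    [alpha r ^ (p + 1) lhat p = L] fixes [alpha] and [r], and since each link lies
    above [- 5], the condition [5 alpha K <= Delta] leaves room for
      [K ~ (L / lhat p) ^ (1/p) Delta n ^ (- (p+1) / 2p) eps ^ (- (p+1) / p)].
    The hypothesis on [n] says that this is at least [1], and [n K / 2] is the lower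
    bound. The dimension is [n K m], that is [n K] up to a logarithm. *)

Set Implicit Arguments.
Unset Strict Implicit.
Unset Printing Implicit Defensive.

Import Order.TTheory GRing.Theory Num.Theory.
Import numFieldNormedType.Exports.

Local Open Scope classical_set_scope.
Local Open Scope ring_scope.

(** * A smooth step with controlled derivatives *)

Section splines.
Context {R : realType}.
Implicit Types (t h : R) (hs : seq R) (g : R -> R).

Lemma mean_value g dg (a b : R) : a < b -> (forall x : R, is_derive x 1 g (dg x)) ->
  exists2 c, a < c < b & g b - g a = dg c * (b - a).
Proof.
move=> ab dgE; have [|c] := @MVT R g dg a b ab (fun x _ => dgE x).
  apply: continuous_subspaceT => x; apply: differentiable_continuous.
  by apply/derivable1_diffP; have [] := dgE x.
by rewrite in_itv/= => cab ?; exists c.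
Qed.

Definition truncated_power k t : R := if t <= 0 then 0 else t ^+ k / k`!%:R.

Lemma truncated_power_le0 k t : t <= 0 -> truncated_power k t = 0.
Proof. by rewrite /truncated_power => ->. Qed.

Lemma truncated_power_gt0 k t : 0 < t -> truncated_power k t = t ^+ k / k`!%:R.
Proof. by move=> t0; rewrite /truncated_power leNgt t0. Qed.

Lemma is_derive_truncated_power k t :
  is_derive t 1 (truncated_power k.+2) (truncated_power k.+1 t).
Proof.
have [t0|t0|->] := ltgtP t 0.
- rewrite truncated_power_le0 ?(ltW t0)//.
  apply: (@near_eq_is_derive _ _ _ (cst (0 : R^o))).
  near=> u; rewrite truncated_power_le0//; apply: ltW.
  by near: u; exact: lt_nbhsl.
- rewrite truncated_power_gt0//.
  apply: (@near_eq_is_derive _ _ _ (fun u : R => (k.+2`!%:R)^-1 *: (u ^+ k.+2))).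
    near=> u; rewrite truncated_power_gt0; first by rewrite mulrC.
    by near: u; exact: lt_nbhsr.
  have HD := @is_deriveZ _ _ _ (fun u : R => u ^+ k.+2) ((k.+2`!%:R)^-1) t 1 _
    (derivableP (@exprn_derivable _ k.+2 t 1)).
  apply: is_derive_eq HD _.
  rewrite exp_derive /GRing.scale/= mulr1 factS natrM.
  have k0 : k.+2%:R != 0 :> R by rewrite pnatr_eq0.
  by rewrite invfM mulrACA mulVf// mul1r mulrC.
rewrite truncated_power_le0//.
suff H : h^-1 *: (((truncated_power k.+2) \o shift 0) (h *: 1) - truncated_power k.+2 0)
     @[h --> (0:R)^'] --> (0:R).
  split; first by apply/cvg_ex; exists 0.
  by apply/cvg_lim.
apply/cvgrPdist_le => e e0.
near=> h.
rewrite sub0r normrN /= addr0 [_%:A]mulr1 (@truncated_power_le0 _ 0)// subr0.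
have [h0|h1] := leP h 0; first by rewrite truncated_power_le0// scaler0 normr0 ltW.
rewrite truncated_power_gt0// /GRing.scale/= exprS -mulrA mulKf ?gt_eqF//.
rewrite ger0_norm; last by rewrite mulr_ge0 ?exprn_ge0 ?invr_ge0 ?ler0n ?ltW.
have hM : `|h| < Num.min 1 e.
  by near: h; apply: dnbhs0_lt; rewrite lt_min ltr01.
have [h2 h3] : h < 1 /\ h < e.
  by move: hM; rewrite (ger0_norm (ltW h1)) lt_min => /andP.
apply: le_trans (ltW h3).
rewrite exprS -mulrA ler_piMr//; first exact: ltW.
rewrite mulr_ile1 ?exprn_ge0 ?invr_ge0 ?ler0n ?exprn_ile1 ?(ltW h1) ?(ltW h2)//.
by rewrite invf_le1 ?ltr0n ?fact_gt0// ler1n fact_gt0.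
Unshelve. all: by end_near. Qed.

(** Each width averages over a window of half-width [h], in the form of the symmetric
    difference quotient of a primitive, which lowers the degree by one.
    For [k = size hs] the result is a mollified Heaviside function, and larger [k]
    gives its iterated primitives. *)
Fixpoint spline hs k t : R :=
  if hs is h :: hs' then (spline hs' k (t + h) - spline hs' k (t - h)) / (2 * h)
  else truncated_power k t.

Lemma is_derive_shiftr g dg c t :
  (forall u : R, is_derive u 1 g (dg u)) -> is_derive t 1 (fun u => g (u + c)) (dg (t + c)).
Proof.
move=> gE; have := @is_derive1_comp _ g (shift c) t _ _ (gE _) (is_derive_shift t 1 c).
by rewrite /= mulr1.
Qed.

Lemma is_derive_spline hs k t :
  is_derive t 1 (spline hs k.+2) (spline hs k.+1 t).
Proof.
elim: hs t => [|h hs IH] t /=; first exact: is_derive_truncated_power.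
have := @is_deriveZ _ _ _ _ (2 * h)^-1 t 1 _
  (@is_deriveB _ _ _ _ _ _ _ _ _ (is_derive_shiftr h t IH) (is_derive_shiftr (- h) t IH)).
rewrite [_ *: _]mulrC => H.
apply: near_eq_is_derive H; near=> u; first by rewrite /= [LHS]mulrC.
Unshelve. all: by end_near. Qed.

Lemma spline_eq0 hs k t : (forall h, h \in hs -> 0 < h) ->
  t <= - \sum_(h <- hs) h -> spline hs k t = 0.
Proof.
elim: hs t => [|h hs IH] t h0; first by rewrite big_nil oppr0; exact: truncated_power_le0.
rewrite big_cons => th /=.
have hp : 0 < h by apply: h0; rewrite mem_head.
have hps h' : h' \in hs -> 0 < h' by move=> h's; apply: h0; rewrite inE h's orbT.
by rewrite !IH ?subr0 ?mul0r//; lra.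
Qed.

(** Averaging in the outermost window is, by the mean value theorem, evaluation at some
    point of the window, so bounds pass from one spline to the next. *)
Lemma spline_cons_mean h hs k t : 0 < h ->
  exists2 c, t - h < c < t + h & spline (h :: hs) k.+2 t = spline hs k.+1 c.
Proof.
move=> h0; have th : t - h < t + h by lra.
have [c cth /= ->] := @mean_value _ _ _ _ th (is_derive_spline hs k).
by exists c => //; field; rewrite gt_eqF.
Qed.

Lemma spline_unit_interval hs t : hs != [::] -> (forall h, h \in hs -> 0 < h) ->
  0 <= spline hs (size hs) t <= 1.
Proof.
case: hs => // h hs _; elim: hs h t => [|h' hs IH] h t h0.
  have hp : 0 < h by apply: h0; rewrite mem_head.
  have E u : 0 < u -> truncated_power 1 u = u.
    by move=> u0; rewrite truncated_power_gt0// expr1 divr1.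
  rewrite /= ler_pdivrMr ?mulr_gt0// divr_ge0 ?mulr_ge0 ?(ltW hp)// ?mul1r ?andbT/=.
    have [h1|h1] := leP (t + h) 0; [rewrite (truncated_power_le0 _ h1)|rewrite (E _ h1)];
    by have [h2|h2] := leP (t - h) 0; [rewrite (truncated_power_le0 _ h2)|rewrite (E _ h2)]; lra.
  have [h1|h1] := leP (t + h) 0; [rewrite (truncated_power_le0 _ h1)|rewrite (E _ h1)];
  by have [h2|h2] := leP (t - h) 0; [rewrite (truncated_power_le0 _ h2)|rewrite (E _ h2)]; lra.
have hp : 0 < h by apply: h0; rewrite mem_head.
have [c _ ->] := spline_cons_mean (h' :: hs) (size hs) t hp.
by apply: IH => x xs; apply: h0; rewrite inE xs orbT.
Qed.

Lemma spline_nondecreasing hs (s t : R) : hs != [::] -> (forall h, h \in hs -> 0 < h) ->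
  s <= t -> spline hs (size hs) s <= spline hs (size hs) t.
Proof.
case: hs => // h hs _; elim: hs h s t => [|h' hs IH] h s t h0 st.
  have hp : 0 < h by apply: h0; rewrite mem_head.
  have E u : 0 < u -> truncated_power 1 u = u.
    by move=> u0; rewrite truncated_power_gt0// expr1 divr1.
  rewrite /= ler_pM2r ?invr_gt0 ?mulr_gt0//.
  have [h1|h1] := leP (t + h) 0; [rewrite (truncated_power_le0 _ h1)|rewrite (E _ h1)];
  have [h2|h2] := leP (t - h) 0; [rewrite (truncated_power_le0 _ h2)|rewrite (E _ h2)
    |rewrite (truncated_power_le0 _ h2)|rewrite (E _ h2)];
  have [h3|h3] := leP (s + h) 0; [rewrite (truncated_power_le0 _ h3)|rewrite (E _ h3)
    |rewrite (truncated_power_le0 _ h3)|rewrite (E _ h3)|rewrite (truncated_power_le0 _ h3)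
    |rewrite (E _ h3)|rewrite (truncated_power_le0 _ h3)|rewrite (E _ h3)];
  by have [h4|h4] := leP (s - h) 0; [rewrite (truncated_power_le0 _ h4)|rewrite (E _ h4)]; lra.
move: st; rewrite le_eqVlt => /predU1P[->//|st].
have hp : 0 < h by apply: h0; rewrite mem_head.
have [c _ /eqP] := mean_value st (is_derive_spline [:: h, h' & hs] (size hs)).
rewrite -subr_ge0 => /eqP ->; rewrite mulr_ge0 ?subr_ge0 ?(ltW st)//=.
rewrite divr_ge0 ?mulr_ge0 ?(ltW hp)// subr_ge0; apply: IH; last lra.
by move=> x xs; apply: h0; rewrite inE xs orbT.
Qed.

Lemma spline_eq1 hs t : hs != [::] -> (forall h, h \in hs -> 0 < h) ->
  \sum_(h <- hs) h <= t -> spline hs (size hs) t = 1.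
Proof.
case: hs => // h hs _; elim: hs h t => [|h' hs IH] h t h0.
  have hp : 0 < h by apply: h0; rewrite mem_head.
  rewrite big_cons big_nil addr0 => ht.
  rewrite /= [truncated_power 1 (t + h)]truncated_power_gt0; last lra.
  have [h1|h1] := leP (t - h) 0.
    rewrite truncated_power_le0// expr1 divr1 subr0.
    have -> : t = h by lra.
    by field; rewrite gt_eqF.
  by rewrite truncated_power_gt0// !expr1 !divr1; field; rewrite gt_eqF.
have hp : 0 < h by apply: h0; rewrite mem_head.
have hps x : x \in h' :: hs -> 0 < x by move=> xs; apply: h0; rewrite inE xs orbT.
rewrite big_cons => ht.
have [c /andP[c1 _] ->] := spline_cons_mean (h' :: hs) (size hs) t hp.
by apply: IH => //; lra.
Qed.

(** The widths in [pre] are spent on derivatives: a symmetric difference quotient of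
    width [h] costs at most [1 / h]. *)
Lemma spline_bound pre hs t : hs != [::] -> (forall h, h \in pre ++ hs -> 0 < h) ->
  `|spline (pre ++ hs) (size hs) t| <= \prod_(h <- pre) h^-1.
Proof.
move=> hs0; elim: pre t => [|h pre IH] t h0.
  rewrite big_nil /=; have /andP[s0 s1] := spline_unit_interval t hs0 h0.
  by rewrite ger0_norm.
have hp : 0 < h by apply: h0; rewrite mem_head.
have hps x : x \in pre ++ hs -> 0 < x by move=> xs; apply: h0; rewrite inE xs orbT.
rewrite big_cons /= normrM [`|_^-1|]gtr0_norm ?invr_gt0 ?mulr_gt0//.
rewrite ler_pdivrMr ?mulr_gt0//.
apply: le_trans (ler_normB _ _) _.
apply: le_trans (lerD (IH _ hps) (IH _ hps)) _.
rewrite le_eqVlt; apply/orP; left; apply/eqP.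
by field; rewrite gt_eqF.
Qed.

(** Quadratic decay makes the widths summable, with a telescoping sum below [1/16],
    while the product of the first [k] inverses is only of order [k! ^ 2]; this is
    the source of the [exp (c p log p)] in the final bound. *)
Definition widths m n : seq R := [seq (16 * i.+1%:R * i.+2%:R)^-1 | i <- iota m n].

Lemma widths_gt0 m n h : h \in widths m n -> 0 < h.
Proof. by move=> /mapP[i _ ->]; rewrite invr_gt0 !mulr_gt0. Qed.

Lemma widthsS n : widths 0 n.+1 = rcons (widths 0 n) (16 * n.+1%:R * n.+2%:R)^-1.
Proof. by rewrite /widths -{1}[n.+1]addn1 iotaD map_cat cats1. Qed.

Lemma sum_widths n : \sum_(h <- widths 0 n) h <= 16^-1 :> R.
Proof.
suff -> : \sum_(h <- widths 0 n) h = 16^-1 - (16 * n.+1%:R)^-1 :> R.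
  by rewrite gerBl invr_ge0 mulr_ge0.
elim: n => [|n IH]; first by rewrite big_nil mulr1 subrr.
rewrite widthsS big_rcons/= IH.
rewrite -[n.+2]addn1 !natrD -[n.+1]addn1 natrD.
have n0 : 0 <= n%:R :> R by [].
by field; rewrite !gt_eqF//; lra.
Qed.

Lemma prod_widths k : \prod_(h <- widths 0 k) h^-1 = 16 ^+ k * k`!%:R * k.+1`!%:R :> R.
Proof.
elim: k => [|k IH]; first by rewrite big_nil expr0 !mul1r.
rewrite widthsS big_rcons/= IH.
by rewrite invrK (factS k.+1) (factS k) exprS !natrM; ring.
Qed.

(** The functions [T j] are the successive derivatives of [T 0], and [T 1] is a
    smooth step from 0 to 1 across [[-1/16, 1/16]]. Finitely many box averages
    suffice for any prescribed order [N] of smoothness, with Gevrey bounds that do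
    not depend on [N]. *)
Lemma smooth_step N : exists T : nat -> R -> R,
  [/\ forall j t, (j <= N)%N -> is_derive t 1 (T j) (T j.+1 t),
      forall t, 0 <= T 1%N t <= 1 /\ 0 <= T 2%N t,
      forall j t, t <= - 16^-1 -> T j t = 0,
      forall t, 16^-1 <= t -> T 1%N t = 1
    & forall j t, (j <= N)%N -> `|T j.+1 t| <= 16 ^+ j * j`!%:R * j.+1`!%:R].
Proof.
pose hs := widths 0 N.+2; have shs : size hs = N.+2 by rewrite size_map size_iota.
have hs0 : hs != [::] by rewrite -size_eq0 shs.
have hsp h : h \in hs -> 0 < h by exact: widths_gt0.
exists (fun j => spline hs (N.+3 - j)%N); split.
- move=> j t jN; have -> : (N.+3 - j = (N.+1 - j).+2)%N by lia.
  by rewrite (_ : N.+3 - j.+1 = (N.+1 - j).+1)%N; [exact: is_derive_spline|lia].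
- move=> t; split; first by rewrite subn1 [_.-1]/= -shs; exact: spline_unit_interval.
  have hsE : hs = (16 * 1%:R * 2%:R)^-1 :: widths 1 N.+1 by [].
  have s1 : size (widths 1 N.+1) = N.+1 by rewrite size_map size_iota.
  have -> : (N.+3 - 2 = size (widths 1 N.+1))%N by rewrite s1; lia.
  have w0 : widths 1 N.+1 != [::] by [].
  have wp h : h \in widths 1 N.+1 -> 0 < h by exact: widths_gt0.
  rewrite hsE; move: (widths 1 N.+1) w0 wp => ws w0 wp /=.
  have c0 : 0 < (16 * 1 * 2 : R)^-1 by rewrite invr_gt0 !mulr_gt0.
  rewrite divr_ge0 ?mulr_ge0 ?(ltW c0)// subr_ge0.
  by apply: spline_nondecreasing => //; lra.
- move=> j t t0; apply: spline_eq0 => //; apply: le_trans t0 _.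
  by rewrite lerN2 sum_widths.
- move=> t t0; rewrite subn1 [_.-1]/= -shs; apply: spline_eq1 => //.
  by apply: le_trans t0; exact: sum_widths.
- move=> j t jN; rewrite -prod_widths.
  have hE : hs = widths 0 j ++ widths j (N.+2 - j).
    by rewrite -map_cat -{2}[j]add0n -iotaD; congr (map _ (iota _ _)); lia.
  have s2 : size (widths j (N.+2 - j)) = (N.+3 - j.+1)%N.
    by rewrite size_map size_iota; lia.
  rewrite hE -s2; apply: spline_bound; first by rewrite -size_eq0 s2; lia.
  by rewrite -hE.
Qed.

End splines.

(** * Iterated directional derivatives *)

Section directional.
Context {R : realType} {d : nat}.
Notation V := 'rV[R]_d.
Implicit Types (f g : V -> R) (x v w : V) (vs : seq V) (T : nat -> R -> R).

Fixpoint dirder f vs : V -> R :=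
  if vs is v :: vs' then fun x => 'D_v (dirder f vs') x else f.

Lemma dirder_rcons f vs v : dirder f (rcons vs v) = dirder ('D_v f) vs.
Proof. by elim: vs => //= w vs ->. Qed.

(** Differentiability of all directional derivatives of order below [N]; the
    recursion peels off the innermost derivative, which is what product and chain
    rules produce. *)
Fixpoint smooth N f : Prop :=
  if N is N'.+1 then (forall x, differentiable f x) /\ forall v, smooth N' ('D_v f)
  else True.

Lemma smoothS N f : smooth N.+1 f ->
  (forall x, differentiable f x) /\ forall v, smooth N ('D_v f).
Proof. by []. Qed.

Lemma smoothW N f : smooth N.+1 f -> smooth N f.
Proof.
elim: N f => //= N IH f [df sf]; split=> // v; apply: IH; exact: sf.
Qed.

Lemma smooth_le M N f : (M <= N)%N -> smooth N f -> smooth M f.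
Proof.
by elim: N => [|N IH]; [case: M|rewrite leq_eqVlt => /predU1P[->//|MN /smoothW]; exact: IH].
Qed.

Lemma smooth_dirder N f vs : smooth (N + size vs) f -> smooth N (dirder f vs).
Proof.
elim/last_ind: vs f => [|vs v IH] f; first by rewrite addn0.
by rewrite dirder_rcons size_rcons addnS => -[_ /(_ v)]; exact: IH.
Qed.

Lemma differentiable_dirder N f vs x : smooth N f -> (size vs < N)%N ->
  differentiable (dirder f vs) x.
Proof.
move=> sf vN; have := @smooth_dirder (N - size vs)%N f vs.
by rewrite subnK ?(ltnW vN)// => /(_ sf); case: (N - size vs)%N (subn_gt0 (size vs) N);
  rewrite vN // => ? _ [].
Qed.

Lemma derive_fun_cst (r : R) v : 'D_v (fun _ : V => r) = fun=> 0.
Proof. by apply/funext => x; rewrite derive_cst. Qed.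

Lemma smooth_cst N (r : R) : smooth N (fun=> r).
Proof.
elim: N r => //= N IH r; split=> [x|v]; first exact: differentiable_cst.
by rewrite derive_fun_cst.
Qed.

Lemma derive_fun_coord (j : 'I_d) v : 'D_v (fun x : V => x 0 j) = fun=> v 0 j.
Proof.
apply/funext => x; have := @derive_mx _ _ _ _ id x v (@derivable_id _ _ x v).
by rewrite derive_id => /matrixP/(_ 0 j); rewrite mxE.
Qed.

Lemma smooth_coord N (j : 'I_d) : smooth N (fun x : V => x 0 j).
Proof.
case: N => //= N; split=> [x|v]; first exact: differentiable_coord.
by rewrite derive_fun_coord; exact: smooth_cst.
Qed.

Lemma derive_funD f g v : (forall x, differentiable f x) -> (forall x, differentiable g x) ->
  'D_v (fun x => f x + g x) = fun x => 'D_v f x + 'D_v g x.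
Proof.
by move=> df dg; apply/funext => x; rewrite (@deriveD _ _ _ f g)//; exact: diff_derivable.
Qed.

Lemma derive_funM f g v : (forall x, differentiable f x) -> (forall x, differentiable g x) ->
  'D_v (fun x => f x * g x) = fun x => 'D_v f x * g x + f x * 'D_v g x.
Proof.
move=> df dg; apply/funext => x; rewrite (@deriveM _ _ f g); try exact: diff_derivable.
by rewrite addrC mulrC.
Qed.

Lemma derive_fun_comp (h dh : R -> R) f v : (forall t : R, is_derive t 1 h (dh t)) ->
  (forall x, differentiable f x) ->
  'D_v (fun x => h (f x)) = fun x => dh (f x) * 'D_v f x.
Proof.
move=> hE df; apply/funext => x.
have dh' t : differentiable h t by apply/derivable1_diffP; have [] := hE t.
rewrite deriveE; last exact: differentiable_comp.
rewrite (@diff_comp _ _ _ _ f h)//= -(deriveE v (df x)) deriv1E; last by have [] := hE (f x).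
by rewrite derive1E derive_val mulrC.
Qed.

Lemma smoothD N f g : smooth N f -> smooth N g -> smooth N (fun x => f x + g x).
Proof.
elim: N f g => // N IH f g /smoothS[df sf] /smoothS[dg sg]; split=> [x|v].
  exact: differentiableD.
by rewrite derive_funD//; exact: IH.
Qed.

Lemma smoothM N f g : smooth N f -> smooth N g -> smooth N (fun x => f x * g x).
Proof.
elim: N f g => // N IH f g sf sg; have [[df sf'] [dg sg']] := (smoothS sf, smoothS sg).
split=> [x|v]; first exact: differentiableM.
by rewrite derive_funM//; apply: smoothD; apply: IH => //; exact: smoothW.
Qed.

Lemma smooth_comp N T j f : (forall i (t : R), (i < j + N)%N -> is_derive t 1 (T i) (T i.+1 t)) ->
  smooth N f -> smooth N (fun x => T j (f x)).
Proof.
elim: N j f => // N IH j f TE sf; have [df sf'] := smoothS sf.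
have TE' (t : R) : is_derive t 1 (T j) (T j.+1 t) by apply: TE; lia.
split=> [x|v].
  by apply: (@differentiable_comp _ _ _ _ f (T j)) => //; apply/derivable1_diffP; case: (TE' (f x)).
rewrite (derive_fun_comp _ TE')//; apply: smoothM => //.
by apply: IH; [move=> i t iN; apply: TE; lia|exact: smoothW].
Qed.

Lemma smooth_sum N (I : Type) (s : seq I) (P : pred I) (F : I -> V -> R) :
  (forall i, smooth N (F i)) -> smooth N (fun x => \sum_(i <- s | P i) F i x).
Proof.
move=> sF; elim: s => [|i s IH].
  by under eq_fun do rewrite big_nil; exact: smooth_cst.
under eq_fun do rewrite big_cons; case: (P i) => //.
by apply: smoothD.
Qed.

Lemma dirderD f g vs x : smooth (size vs) f -> smooth (size vs) g ->
  dirder (fun x => f x + g x) vs x = dirder f vs x + dirder g vs x.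
Proof.
elim/last_ind: vs f g => // vs v IH f g; rewrite size_rcons => /smoothS[df sf] /smoothS[dg sg].
by rewrite !dirder_rcons derive_funD// IH.
Qed.

Lemma dirder_cst (r : R) vs x : dirder (fun=> r) vs x = if vs is [::] then r else 0.
Proof.
elim/last_ind: vs r => // vs v IH r; rewrite dirder_rcons derive_fun_cst IH.
by case: vs {IH}.
Qed.

Lemma dirder_sum (I : Type) (s : seq I) (P : pred I) (F : I -> V -> R) vs x :
  (forall i, smooth (size vs) (F i)) ->
  dirder (fun x => \sum_(i <- s | P i) F i x) vs x = \sum_(i <- s | P i) dirder (F i) vs x.
Proof.
move=> sF; elim: s => [|i s IH].
  by under eq_fun do rewrite big_nil; rewrite dirder_cst big_nil; case: vs sF.
rewrite big_cons; under eq_fun do rewrite big_cons; case: (P i) => //.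
by rewrite dirderD// ?IH//; exact: smooth_sum.
Qed.

Lemma derive_fun_scale (a : R) f g v : (forall x, f x = a * g x) ->
  (forall x, differentiable g x) -> 'D_v f = fun x => a * 'D_v g x.
Proof.
move=> /funext -> dg; rewrite derive_funM//.
  by apply/funext => x; rewrite derive_cst mul0r add0r.
Qed.

Lemma derive_fun_rescale (a r : R) g v : (forall x, differentiable g x) ->
  'D_v (fun x => a * g (r *: x)) = fun x => a * r * 'D_v g (r *: x).
Proof.
move=> dg; apply/funext => x.
have sE : 'D_v (fun x => g (r *: x)) x = r * 'D_v g (r *: x).
  rewrite deriveE; last by apply: (@differentiable_comp _ _ _ _ ( *:%R r) g).
  rewrite (@diff_comp _ _ _ _ ( *:%R r) g)//= diff_val -(deriveE _ (dg _)).
  by rewrite !deriveE// linearZ.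
rewrite (congr1 (@^~ x) (@derive_fun_scale a _ (fun x => g (r *: x)) v (fun=> erefl) _)).
  by rewrite [LHS]/= sE mulrA.
by move=> y; apply: (@differentiable_comp _ _ _ _ ( *:%R r) g).
Qed.

Lemma smooth_rescale N (a r : R) g : smooth N g -> smooth N (fun x => a * g (r *: x)).
Proof.
elim: N a g => // N IH a g /smoothS[dg sg]; split=> [x|v]; last first.
  by rewrite derive_fun_rescale//; exact: (IH _ ('D_v g)).
apply: (@differentiableM _ _ (fun=> a)); first exact: differentiable_cst.
exact: (@differentiable_comp _ _ _ _ ( *:%R r) g).
Qed.

Lemma dirder_rescale (a r : R) g vs x : smooth (size vs) g ->
  dirder (fun x => a * g (r *: x)) vs x = a * r ^+ size vs * dirder g vs (r *: x).
Proof.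
elim/last_ind: vs a g => [|vs v IH] a g; first by rewrite expr0 mulr1.
rewrite size_rcons => /smoothS[dg sg]; rewrite !dirder_rcons derive_fun_rescale//.
rewrite (IH _ ('D_v g))//.
by rewrite exprS; ring.
Qed.

Lemma dirderZ (a : R) g vs x : smooth (size vs) g ->
  dirder (fun x => a * g x) vs x = a * dirder g vs x.
Proof.
move=> sg; have := dirder_rescale a 1 x sg; rewrite expr1n mulr1 scale1r => <-.
by congr (dirder _ vs x); apply/funext => y; rewrite scale1r.
Qed.

(** Being the value of a linear form, a directional derivative is a combination
    of partial derivatives; iterating this identifies [contract]ions of the
    derivative tensors with iterated directional derivatives. *)
Lemma derive_partial f x v : differentiable f x ->
  'D_v f x = \sum_(j < d) v 0 j * 'D_(delta_mx 0 j) f x.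
Proof.
move=> df; rewrite deriveE// {1}(row_sum_delta v) linear_sum.
by apply: eq_bigr => j _; rewrite linearZ -deriveE.
Qed.

Lemma pderivE f (s : seq 'I_d) : pderiv f s = dirder f [seq delta_mx 0 j | j <- s].
Proof. by elim: s => //= j s ->. Qed.

Lemma contract_deriv_tensor k f x (v : 'I_k -> V) : smooth k f ->
  Defs.contract (deriv_tensor k f x) v = dirder f [seq v j | j <- enum 'I_k] x.
Proof.
elim: k v x => [|k IH] v x sf.
  rewrite /Defs.contract (big_pred1 [tuple]) => [|s]; last by rewrite [s]tuple0 /= eqxx.
  by rewrite big_ord0 mulr1 ffunE enum_ord0.
rewrite enum_ordSl /= -map_comp.
have dg : differentiable (dirder f [seq (v \o lift ord0) j | j <- enum 'I_k]) x.
  by apply: (differentiable_dirder _ sf); rewrite size_map size_enum_ord.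
rewrite derive_partial//.
transitivity (\sum_(j < d) \sum_(s : k.-tuple 'I_d) v ord0 0 j * ('D_(delta_mx 0 j) (pderiv f s) x
  * \prod_(l < k) v (lift ord0 l) 0 (tnth s l))); last first.
  apply: eq_bigr => j _; rewrite -mulr_sumr; congr (_ * _).
  have -> : dirder f [seq (v \o lift ord0) j | j <- enum 'I_k] =
      fun y => \sum_(s : k.-tuple 'I_d) (\prod_(l < k) v (lift ord0 l) 0 (tnth s l)) * pderiv f s y.
    apply/funext => y; rewrite -IH; last exact: smoothW.
    by apply: eq_bigr => s _; rewrite ffunE mulrC.
  have ds (s : k.-tuple 'I_d) y : differentiable (pderiv f s) y.
    rewrite pderivE; apply: (differentiable_dirder _ sf).
    by rewrite size_map size_tuple.
  set c := fun s : k.-tuple 'I_d => \prod_(l < k) v (lift ord0 l) 0 (tnth s l).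
  have sc (s : k.-tuple 'I_d) : smooth 1 (fun y => c s * pderiv f s y).
    by split=> // y; apply: (@differentiableM _ _ (fun=> c s)) => //; exact: differentiable_cst.
  have /= -> := @dirder_sum _ (index_enum _) predT _ [:: delta_mx 0 j] x sc.
  apply: eq_bigr => s _; rewrite mulrC.
  by rewrite (congr1 (@^~ x) (@derive_fun_scale (c s) _ (pderiv f s) _ (fun=> erefl) (ds s))).
rewrite pair_big /= /Defs.contract.
rewrite (reindex (fun p : 'I_d * k.-tuple 'I_d => [tuple of p.1 :: p.2])) /=; last first.
  exists (fun t => (thead t, [tuple of behead t])) => [[j s] _|t _] /=.
    by rewrite theadE; congr (_, _); apply: val_inj.
  by rewrite [RHS]tuple_eta.
apply: eq_bigr => -[j s] _ /=; rewrite ffunE big_ord_recl tnth0 /= mulrCA; congr (_ * (_ * _)).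
by apply: eq_bigr => l _; rewrite tnthS.
Qed.

Section bounds.
Variables (nu : V -> R) (x : V).
Hypothesis nu_ge0 : forall v, 0 <= nu v.

(** The weight [nu] is a seminorm measuring only the coordinates on which [f]
    depends; this is what keeps bounds for sums over the chain free of the
    dimension. *)
Definition bounded_at K (A : R) f :=
  forall vs, (size vs <= K)%N -> `|dirder f vs x| <= A * \prod_(v <- vs) nu v.

Lemma bounded_at_derive K A f v : bounded_at K.+1 A f -> bounded_at K (A * nu v) ('D_v f).
Proof.
move=> Af vs sv; rewrite -dirder_rcons; apply: le_trans (Af _ _) _; first by rewrite size_rcons.
by rewrite big_rcons/= mulrAC mulrA.
Qed.

Lemma bounded_atS K A f : bounded_at K.+1 A f -> bounded_at K A f.
Proof. by move=> Af vs sv; apply: Af; exact: leqW. Qed.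

(** Leibniz, with each of the [2 ^ k] terms bounded by the product of the bounds. *)
Lemma dirderM_bound K A B f g vs : smooth K f -> smooth K g ->
  bounded_at K A f -> bounded_at K B g -> (size vs <= K)%N ->
  `|dirder (fun y => f y * g y) vs x| <= 2 ^+ size vs * (A * B) * \prod_(v <- vs) nu v.
Proof.
elim/last_ind: vs K A B f g => [|vs v IH] K A B f g sf sg Af Bg sv.
  have := ler_pM _ _ (Af [::] isT) (Bg [::] isT).
  by rewrite !big_nil !mulr1 expr0 mul1r normrM => -> //.
case: K sf sg Af Bg sv => [|K] sf sg Af Bg; rewrite size_rcons// ltnS => sv.
have [[df sf'] [dg sg']] := (smoothS sf, smoothS sg).
rewrite dirder_rcons derive_funM// dirderD; last 2 first.
- by apply: (@smooth_le _ K) => //; apply: smoothM => //; exact: smoothW.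
- by apply: (@smooth_le _ K) => //; apply: smoothM => //; exact: smoothW.
apply: le_trans (ler_normD _ _) _.
have H1 := IH K _ _ _ _ (sf' v) (smoothW sg) (bounded_at_derive v Af) (bounded_atS Bg) sv.
have H2 := IH K _ _ _ _ (smoothW sf) (sg' v) (bounded_atS Af) (bounded_at_derive v Bg) sv.
apply: le_trans (lerD H1 H2) _.
rewrite big_rcons/= exprS le_eqVlt; apply/orP; left; apply/eqP; ring.
Qed.

(** An affine factor survives at most one differentiation, so the Leibniz expansion
    has [size vs + 1] nonzero terms instead of [2 ^ size vs]. *)
Lemma dirderM_affine_bound (c H : R) l h (dl : V -> R) vs : smooth (size vs) l -> smooth (size vs) h ->
  (forall v, 'D_v l = fun=> dl v) -> `|l x| <= c -> (forall v, `|dl v| <= c * nu v) ->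
  bounded_at (size vs) H h ->
  `|dirder (fun y => l y * h y) vs x| <= (size vs).+1%:R * (c * H) * \prod_(v <- vs) nu v.
Proof.
move=> + + lE lc dlc; elim/last_ind: vs H h => [|vs v IH] H h sl sh hb.
  have := ler_pM (normr_ge0 _) (normr_ge0 _) lc (hb [::] isT).
  by rewrite /= big_nil !mulr1 mul1r normrM.
move: sl sh hb; rewrite size_rcons => /smoothS[df sl] /smoothS[dh sh] hb.
have sl0 : smooth (size vs) l.
  by case: (size vs) => // N; split=> // w; rewrite lE; exact: smooth_cst.
have sh0 : smooth (size vs) h by apply: smoothW.
rewrite dirder_rcons derive_funM// dirderD; last 2 first.
- by apply: smoothM.
- by apply: smoothM.
apply: le_trans (ler_normD _ _) _.
have H1 := IH _ _ sl0 (sh v) (bounded_at_derive v hb).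
have -> : (fun y => 'D_v l y * h y) = fun y => dl v * h (1 *: y).
  by apply/funext => y; rewrite (congr1 (@^~ y) (lE v)) scale1r.
rewrite dirder_rescale// scale1r expr1n mulr1 normrM.
have H2 := ler_pM (normr_ge0 _) (normr_ge0 _) (dlc v) (hb vs (leqnSn _)).
apply: le_trans (lerD H2 H1) _.
rewrite big_rcons/= -[(size vs).+2]addn1 natrD le_eqVlt; apply/orP; left; apply/eqP; ring.
Qed.

(** A composition with a quadratic function [b]: each differentiation either hits
    the outer function, at the price of a factor [c], or one of at most [k] affine
    factors already produced, whence [k! * c ^ k] and no worse. *)
Lemma dirder_comp_quadratic (c a : R) T (b : V -> R) (db : V -> V -> R) j N vs :
  (forall i (t : R), (i < j + N)%N -> is_derive t 1 (T i) (T i.+1 t)) -> smooth N b -> (size vs <= N)%N ->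
  (forall v w, 'D_w ('D_v b) = fun=> db v w) ->
  (forall v w, `|db v w| <= c * nu v * nu w) -> (forall v, `|'D_v b x| <= c * nu v) -> 1 <= c ->
  (forall i, (i <= j + size vs)%N -> `|T i (b x)| <= a) ->
  `|dirder (fun y => T j (b y)) vs x| <= (size vs)`!%:R * c ^+ size vs * a * \prod_(v <- vs) nu v.
Proof.
move=> + + + dbE dbc bc c1; have [n] := ubnP (size vs).
elim: n vs j N => // n IH; case/lastP => [|vs v] j N vn TE sb sv Ta.
  by rewrite /= expr0 big_nil !mul1r mulr1; apply: Ta; lia.
have a0 : 0 <= a by apply: le_trans (normr_ge0 _) (Ta 0 _); lia.
have c0 : 0 <= c by lra.
case: N TE sb sv => [|N] TE sb; move: vn Ta; rewrite !size_rcons// !ltnS => vn Ta sv.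
have [df sb'] := smoothS sb.
have TE' (t : R) : is_derive t 1 (T j) (T j.+1 t) by apply: TE; lia.
have TE2 i (t : R) : (i < j.+1 + N)%N -> is_derive t 1 (T i) (T i.+1 t).
  by move=> iN; apply: TE; lia.
rewrite dirder_rcons (derive_fun_comp v TE' df).
under eq_fun do rewrite mulrC.
have H := @dirderM_affine_bound (c * nu v) ((size vs)`!%:R * c ^+ size vs * a) ('D_v b)
  (fun y => T j.+1 (b y)) (db v) vs.
apply: le_trans (H _ _ _ _ _ _) _ => {H}.
- by apply: smooth_le (sb' v).
- apply: (@smooth_le _ N) => //; apply: smooth_comp TE2 _; exact: smoothW.
- by move=> w; rewrite dbE.
- exact: bc.
- by move=> w; rewrite dbc.
- move=> us sus; apply: le_trans (IH us j.+1 N _ TE2 (smoothW sb) _ _) _.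
  + exact: leq_ltn_trans vn.
  + exact: leq_trans sv.
  + by move=> i ij; apply: Ta; lia.
  + rewrite ler_wpM2r ?prodr_ge0// ler_wpM2r// ler_pM ?exprn_ge0//.
      by rewrite ler_nat; exact: leq_fact.
    by rewrite ler_weXn2l.
rewrite big_rcons/= factS natrM exprS le_eqVlt; apply/orP; left; apply/eqP; ring.
Qed.

End bounds.

End directional.

(** * Euclidean geometry of coordinate blocks *)

Section block_norms.
Context {R : realType} {d : nat}.
Notation V := 'rV[R]_d.
Implicit Types (P : pred 'I_d) (u v w x y : V).

Definition bdot P u v : R := \sum_(c | P c) u 0 c * v 0 c.
Definition bnorm P v : R := Num.sqrt (bdot P v v).

Lemma bdot_ge0 P v : 0 <= bdot P v v.
Proof. by apply: sumr_ge0 => c _; exact: sqr_ge0. Qed.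

Lemma bnorm_ge0 P v : 0 <= bnorm P v.
Proof. exact: sqrtr_ge0. Qed.

Lemma sqr_bnorm P v : bnorm P v ^+ 2 = bdot P v v.
Proof. by rewrite sqr_sqrtr// bdot_ge0. Qed.

Lemma bdotC P u v : bdot P u v = bdot P v u.
Proof. by apply: eq_bigr => c _; rewrite mulrC. Qed.

Lemma bdotDr P u v w : bdot P u (v + w) = bdot P u v + bdot P u w.
Proof. by rewrite -big_split; apply: eq_bigr => c _; rewrite mxE mulrDr. Qed.

Lemma bdotZr P u a v : bdot P u (a *: v) = a * bdot P u v.
Proof. by rewrite mulr_sumr; apply: eq_bigr => c _; rewrite mxE mulrCA. Qed.

Lemma bdotNr P u v : bdot P u (- v) = - bdot P u v.
Proof. by rewrite -scaleN1r bdotZr mulN1r. Qed.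

Lemma bdotBr P u v w : bdot P u (v - w) = bdot P u v - bdot P u w.
Proof. by rewrite bdotDr bdotNr. Qed.

Lemma enormE v : enorm v = bnorm predT v.
Proof. by congr Num.sqrt; apply: eq_bigr => c _; rewrite expr2. Qed.

Lemma bnorm0 P : bnorm P 0 = 0.
Proof. by rewrite /bnorm /bdot big1 ?sqrtr0// => c _; rewrite mxE mul0r. Qed.

Lemma bnormZ P a v : bnorm P (a *: v) = `|a| * bnorm P v.
Proof.
by rewrite /bnorm bdotZr bdotC bdotZr mulrA -expr2 sqrtrM ?sqr_ge0// sqrtr_sqr.
Qed.

Lemma bnorm_coord_eq0 P v c : P c -> bnorm P v = 0 -> v 0 c = 0.
Proof.
move=> Pc /eqP; rewrite -sqrf_eq0 sqr_bnorm => /eqP v0.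
have /psumr_eq0P : forall c, P c -> 0 <= v 0 c * v 0 c by move=> *; exact: sqr_ge0.
by move=> /(_ v0 c Pc)/eqP; rewrite mulf_eq0 orbb => /eqP.
Qed.

(** Cauchy-Schwarz. *)
Lemma bdot_le P u v : `|bdot P u v| <= bnorm P u * bnorm P v.
Proof.
have [u0|u0] := eqVneq (bnorm P u) 0.
  by rewrite u0 mul0r /bdot big1 ?normr0// => c Pc; rewrite (bnorm_coord_eq0 Pc u0) mul0r.
have [v0|v0] := eqVneq (bnorm P v) 0.
  by rewrite v0 mulr0 /bdot big1 ?normr0// => c Pc; rewrite (bnorm_coord_eq0 Pc v0) mulr0.
have a0 : 0 < bnorm P u * bnorm P v by rewrite mulr_gt0// lt0r ?u0 ?v0 bnorm_ge0.
have H e : e ^+ 2 = 1 -> 0 <= 2 * (bnorm P u * bnorm P v) ^+ 2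
    - 2 * e * (bnorm P u * bnorm P v) * bdot P u v.
  move=> e1; have := bdot_ge0 P (bnorm P v *: u - (e * bnorm P u) *: v).
  rewrite !(bdotBr, bdotZr) ![bdot P (_ - _) _]bdotC !(bdotBr, bdotZr) -!sqr_bnorm (bdotC P v u).
  set D := bdot P u v; set a := bnorm P u; set b := bnorm P v.
  have -> : b * (b * a ^+ 2 - e * a * D) - e * a * (b * D - e * a * b ^+ 2) =
    (1 + e ^+ 2) * (a * b) ^+ 2 - 2 * e * (a * b) * D by ring.
  by rewrite e1.
have H1 := H 1 (expr1n _ 2); have H2 : _ := H (- 1) _.
rewrite sqrrN expr1n in H2; move: (H2 erefl) H1.
set D := bdot P u v; set a := bnorm P u * bnorm P v => H2' H1'.
by rewrite ler_norml; apply/andP; split; rewrite -(ler_pM2l a0) -/a; lra.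
Qed.

Lemma bnorm_le_enorm P v : bnorm P v <= enorm v.
Proof.
rewrite enormE ler_sqrt ?bdot_ge0// /bdot [leLHS]big_mkcond.
by apply: ler_sum => c _; case: ifP => // _; exact: sqr_ge0.
Qed.

End block_norms.

Section lipschitz.
Context {R : realType} {d : nat}.
Notation V := 'rV[R]_d.

(** The mean value theorem along the segment from [y] to [x]. *)
Lemma dirder_segment (g : V -> R) (x y : V) : (forall z, differentiable g z) ->
  exists z, g x - g y = 'D_(x - y) g z.
Proof.
move=> dg; set w := x - y.
have ds t : differentiable (fun t : R => t *: w + y) t by [].
have gE (t : R) : is_derive t 1 (fun t : R => g (t *: w + y)) ('D_w g (t *: w + y)).
  have dc : differentiable (fun t : R => g (t *: w + y)) t.
    exact: (@differentiable_comp _ _ _ _ (fun t : R => t *: w + y) g).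
  split; first exact: diff_derivable.
  rewrite deriveE// (@diff_comp _ _ _ _ (fun t : R => t *: w + y) g)//= deriveE//.
  congr ('d _ _ _); rewrite -deriveE//.
  have -> : (fun t : R => t *: w + y) = (fun t : R => t *: w) + cst y by [].
  have d1 : derivable (fun t : R => t *: w) t 1 by exact: diff_derivable.
  rewrite (deriveD d1 (derivable_cst y t 1)) [X in _ + X = _]derive_cst addr0.
  by rewrite deriveE// diff_val scale1r.
have [c _ /= H] := mean_value ltr01 gE.
exists (c *: w + y); move: H; rewrite scale1r scale0r add0r subr0 mulr1 /w subrK.
by [].
Qed.

(** A contraction of the difference of two derivative tensors is a difference of
    directional derivatives of order [p], which one more derivative, in the
    direction [x - y], controls. *)
Lemma opnorm_lipschitz p (L : R) (f : V -> R) : smooth p.+1 f -> 0 <= L ->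
  (forall vs x, size vs = p.+1 -> (forall v, v \in vs -> enorm v <= 1) ->
    `|dirder f vs x| <= L) ->
  forall x y, opnorm (deriv_tensor p f x - deriv_tensor p f y) <= L * enorm (x - y).
Proof.
move=> sf L0 fL x y; apply: sup_le_ub.
  by exists `|Defs.contract (deriv_tensor p f x - deriv_tensor p f y) (fun=> 0)|;
     exists (fun=> 0) => //= j; rewrite enormE bnorm0.
move=> _ [v /= v1 <-].
have -> : Defs.contract (deriv_tensor p f x - deriv_tensor p f y) v =
    Defs.contract (deriv_tensor p f x) v - Defs.contract (deriv_tensor p f y) v.
  rewrite /Defs.contract -sumrB; apply: eq_bigr => s _.
  by rewrite !ffunE mulrBl.
rewrite !contract_deriv_tensor; try exact: smoothW.
set vs := [seq v j | j <- enum 'I_p].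
have svs : size vs = p by rewrite size_map size_enum_ord.
have dg z : differentiable (dirder f vs) z by apply: differentiable_dirder sf _; rewrite svs.
have [z ->] := dirder_segment x y dg.
have [xy0|xy0] := eqVneq (enorm (x - y)) 0.
  have -> : x - y = 0.
    by apply/rowP => c; rewrite (bnorm_coord_eq0 (P := predT) (v := x - y) (c := c))// ?mxE// -enormE.
  by rewrite derive0 normr0 mulr_ge0// sqrtr_ge0.
have xyp : 0 < enorm (x - y) by rewrite lt0r xy0 sqrtr_ge0.
rewrite -[X in 'D_X _ _]scale1r -(divff xy0) -scalerA deriveE// linearZ -deriveE// normrM.
rewrite (ger0_norm (ltW xyp)) mulrC ler_pM2r//.
apply: (fL (_ :: vs)); first by rewrite /= svs.
move=> w; rewrite inE => /predU1P[->|/mapP[j _ ->]]; last exact: v1.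
by rewrite enormE bnormZ -enormE gtr0_norm ?invr_gt0// mulVf.
Qed.

End lipschitz.

(** * The hard chain *)

Section quadratics.
Context {R : realType} {d : nat}.
Notation V := 'rV[R]_d.
Implicit Types (P : pred 'I_d) (u v w x y : V).

Definition sqdist P u x : R := bdot P (x - u) (x - u).

Lemma derive_bdot P u v : 'D_v (bdot P u) = fun=> bdot P u v.
Proof.
have sF (c : 'I_d) : smooth 1 (fun x : V => u 0 c * x 0 c).
  by apply: smoothM; [exact: smooth_cst|exact: smooth_coord].
apply/funext => x; have /= -> := @dirder_sum _ _ _ (index_enum _) P _ [:: v] x sF.
apply: eq_bigr => c _.
have dc y : differentiable (fun x : V => x 0 c) y by exact: differentiable_coord.
by rewrite (congr1 (@^~ x) (derive_fun_scale v (fun=> erefl) dc))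
  (congr1 (@^~ x) (derive_fun_coord c v)).
Qed.

Lemma smooth_bdot N P u : smooth N (bdot P u).
Proof.
by apply: smooth_sum => c; apply: smoothM; [exact: smooth_cst|exact: smooth_coord].
Qed.

Lemma smooth_sqdist N P u : smooth N (sqdist P u).
Proof.
apply: smooth_sum => c; have h : smooth N (fun x : V => (x - u) 0 c).
  under eq_fun do rewrite !mxE; apply: smoothD; first exact: smooth_coord.
  exact: smooth_cst.
exact: smoothM.
Qed.

Lemma sqdistE P u x : sqdist P u x = sqdist P 0 x + (- 2 * bdot P u x + bdot P u u).
Proof.
rewrite /sqdist subr0 !(bdotBr, bdotC P (x - u)) (bdotC P x u); ring.
Qed.

Lemma derive_sqdist P u v : 'D_v (sqdist P u) = fun x => 2 * bdot P v (x - u).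
Proof.
have D0 : 'D_v (sqdist P 0) = fun x => 2 * bdot P v x.
  have sF (c : 'I_d) : smooth 1 (fun x : V => (x - 0) 0 c * (x - 0) 0 c).
    under eq_fun do rewrite subr0; apply: smoothM; exact: smooth_coord.
  apply/funext => x; have /= -> := @dirder_sum _ _ _ (index_enum _) P _ [:: v] x sF.
  rewrite mulr_sumr; apply: eq_bigr => c _.
  under eq_fun do rewrite subr0.
  have dc y : differentiable (fun x : V => x 0 c) y by exact: differentiable_coord.
  rewrite (congr1 (@^~ x) (derive_funM v dc dc)) (congr1 (@^~ x) (derive_fun_coord c v)); ring.
have [ds _] := smooth_sqdist 1 P 0; have [db _] := smooth_bdot 1 P u.
have dc (r : R) (y : V) : differentiable (fun=> r) y by exact: differentiable_cst.
have db' (y : V) : differentiable (fun y => - 2 * bdot P u y) y.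
  by apply: (@differentiableM _ _ (fun=> - 2)).
have -> : sqdist P u = fun x => sqdist P 0 x + (- 2 * bdot P u x + bdot P u u).
  by apply/funext => x; exact: sqdistE.
rewrite derive_funD// ?D0; last by move=> y; exact: differentiableD.
apply/funext => x; rewrite (congr1 (@^~ x) (derive_funD v db' (dc _))).
rewrite (congr1 (@^~ x) (derive_fun_scale v (fun=> erefl) db)) derive_cst.
rewrite (congr1 (@^~ x) (derive_bdot P u v)) (congr1 (@^~ x) D0).
rewrite bdotBr (bdotC P v u); ring.
Qed.

Lemma derive2_sqdist P u v w : 'D_w ('D_v (sqdist P u)) = fun=> 2 * bdot P v w.
Proof.
have [db _] := smooth_bdot 1 P v.
rewrite derive_sqdist; apply/funext => x.
have -> : (fun x : V => 2 * bdot P v (x - u)) = fun x => 2 * bdot P v x + - 2 * bdot P v u.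
  by apply/funext => y; rewrite bdotBr; ring.
have db' (y : V) : differentiable (fun y => 2 * bdot P v y) y.
  by apply: (@differentiableM _ _ (fun=> 2)) => //; exact: differentiable_cst.
have dc (r : R) (y : V) : differentiable (fun=> r) y by exact: differentiable_cst.
rewrite (congr1 (@^~ x) (derive_funD w db' (dc _))).
rewrite (congr1 (@^~ x) (derive_fun_scale w (fun=> erefl) db)) derive_cst addr0.
by rewrite (congr1 (@^~ x) (derive_bdot P v w)).
Qed.

Lemma derive_half_sqdist P v : 'D_v (fun x => 2^-1 * sqdist P 0 x) = bdot P v.
Proof.
have [ds _] := smooth_sqdist 1 P 0.
apply/funext => x; rewrite (congr1 (@^~ x) (derive_fun_scale v (fun=> erefl) ds)).
by rewrite (congr1 (@^~ x) (derive_sqdist P 0 v)) subr0 mulrA mulVf// mul1r.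
Qed.

Lemma dirder_half_sqdist_bound P vs x : (2 <= size vs)%N ->
  `|dirder (fun x => 2^-1 * sqdist P 0 x) vs x| <= \prod_(v <- vs) bnorm P v.
Proof.
case/lastP: vs => // vs v; case/lastP: vs => // vs w _.
rewrite !dirder_rcons derive_half_sqdist derive_bdot dirder_cst !big_rcons/=.
case: vs => [|w' vs]; first by rewrite big_nil mul1r mulrC; exact: bdot_le.
by rewrite normr0 !mulr_ge0 ?bnorm_ge0// prodr_ge0// => ? _; exact: bnorm_ge0.
Qed.

End quadratics.

Section chain.
Context {R : realType} {n d : nat}.
Notation V := 'rV[R]_d.
Variables (N : nat) (T : nat -> R -> R).
Hypothesis TE : forall j (t : R), (j <= N)%N -> is_derive t 1 (T j) (T j.+1 t).
Hypothesis T_unit : forall t, 0 <= T 1%N t <= 1.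
Hypothesis T_slope : forall t, 0 <= T 2%N t.
Hypothesis T_eq0 : forall j t, t <= - 16^-1 -> T j t = 0.
Hypothesis T_eq1 : forall t, 16^-1 <= t -> T 1%N t = 1.
Hypothesis T_bound : forall j t, (j <= N)%N -> `|T j.+1 t| <= 16 ^+ j * j`!%:R * j.+1`!%:R.

(** [own c = (i, j)] when coordinate [c] belongs to the [j]-th block of the
    [i]-th component. *)
Variable own : 'I_d -> 'I_n * nat.
Notation blk i j := [pred c | own c == (i, j : nat)].
Implicit Types (u v w x y : V) (i : 'I_n) (j k : nat) (vs : seq V).

(** A bounded function whose derivative is a plateau: the step at [- 2] switches the
    slope on and the step at [3] switches it off. The index counts derivatives. *)
Definition ridge_profile k (t : R) : R := T k (t + 2) - T k (t - 3).

(** The gate in front of block [j] opens inside a small ball about the hidden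
    vector of block [j - 1]; the first block is always accessible. *)
Definition gate u i j x : R :=
  if j is j'.+1 then T 1 (3 / 16 - sqdist (blk i j') u x) else 1.
Definition ridge u i j x : R := ridge_profile 0 (bdot (blk i j) u x).
Definition link u i j x : R :=
  2^-1 * sqdist (blk i j) 0 x - gate u i j x * ridge u i j x.
Definition chain K u i x : R := \sum_(j < K) link u i j x.

(** The next gate is closed where [seen] fails and fully open where [passed] holds. *)
Definition seen u i j x := sqdist (blk i j) u x < 4^-1.
Definition passed u i j x := sqdist (blk i j) u x <= 8^-1.

Lemma is_derive_ridge_profile k (t : R) : (k <= N)%N ->
  is_derive t 1 (ridge_profile k) (ridge_profile k.+1 t).
Proof.
by move=> kN; apply: is_deriveB; apply: is_derive_shiftr => u; exact: TE.
Qed.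

Lemma ridge_profile_range t : 0 <= ridge_profile 0 t <= 5.
Proof.
have [] := @mean_value _ (T 0) (T 1) (t - 3) (t + 2); first lra.
  by move=> u; exact: TE.
by move=> c _ cE; have := T_unit c; rewrite /ridge_profile cE; lra.
Qed.

Lemma ridge_range u i j x : 0 <= ridge u i j x <= 5.
Proof. exact: ridge_profile_range. Qed.

Lemma ridge_slope_range t : 0 <= ridge_profile 1 t <= 1.
Proof.
rewrite /ridge_profile; have := T_unit (t + 2); have := T_unit (t - 3).
have [t2|t2] := leP (-1) t; first by rewrite (T_eq1 (t := t + 2)); lra.
by rewrite (T_eq0 _ (t := t - 3)); lra.
Qed.

Lemma ridge_slope_eq1 t : -1 <= t <= 2 -> ridge_profile 1 t = 1.
Proof.
by move=> t12; rewrite /ridge_profile T_eq1 ?T_eq0 ?subr0//; lra.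
Qed.

Lemma gate_range u i j x : 0 <= gate u i j x <= 1.
Proof. by case: j => [|j]; [rewrite ler01 lexx|exact: T_unit]. Qed.

Lemma gate_passed u i j x : passed u i j x -> gate u i j.+1 x = 1.
Proof. by rewrite /passed => h; rewrite /gate T_eq1//; lra. Qed.

Lemma smooth_gate u i j : smooth N (gate u i j).
Proof.
case: j => [|j]; first exact: smooth_cst.
apply: (@smooth_comp _ _ N T 1 (fun x => 3 / 16 - sqdist (blk i j) u x)).
under eq_fun do rewrite -mulN1r.
apply: smoothD; first exact: smooth_cst.
by apply: smoothM; [exact: smooth_cst|exact: smooth_sqdist].
Qed.

Lemma smooth_ridge u i j : smooth N (ridge u i j).
Proof.
apply: (@smooth_comp _ _ N ridge_profile 0 (bdot (blk i j) u)).
  by move=> k t kN; apply: is_derive_ridge_profile; exact: ltnW.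
exact: smooth_bdot.
Qed.

Lemma smooth_link u i j : smooth N (link u i j).
Proof.
rewrite /link; under eq_fun do rewrite -mulN1r.
apply: smoothD; first by apply: smoothM; [exact: smooth_cst|exact: smooth_sqdist].
apply: smoothM; first exact: smooth_cst.
by apply: smoothM; [exact: smooth_gate|exact: smooth_ridge].
Qed.

Lemma smooth_chain K u i : smooth N (chain K u i).
Proof. by apply: smooth_sum => j; exact: smooth_link. Qed.

Definition step_bound k : R := 16 ^+ k * k`!%:R * k.+1`!%:R.

Lemma step_bound_ge1 k : 1 <= step_bound k.
Proof.
rewrite /step_bound -mulrA mulr_ege1 ?exprn_ege1 ?ler1n//.
by rewrite mulr_ege1 ?ler1n ?fact_gt0.
Qed.

Lemma step_bound_le j k : (j <= k)%N -> step_bound j <= step_bound k.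
Proof.
move=> jk; rewrite /step_bound !ler_pM ?mulr_ge0 ?exprn_ge0 ?ler0n//.
- by rewrite ler_weXn2l ?ler1n.
- by rewrite ler_nat leq_fact.
- by rewrite ler_nat leq_fact.
Qed.

Lemma ridge_profile_bound j k t : (j <= k)%N -> (k <= N)%N -> `|ridge_profile j t| <= 5 * step_bound k.
Proof.
move=> jk kN; case: j jk => [|j] jk.
  have /andP[r0 r5] := ridge_profile_range t; rewrite ger0_norm//.
  by have := step_bound_ge1 k; lra.
have jN : (j <= N)%N by lia.
rewrite /ridge_profile; apply: le_trans (ler_normB _ _) _.
have H := T_bound _ jN; have := H (t + 2); have := H (t - 3).
have jk' : (j <= k)%N by lia.
have := step_bound_le jk'; have := step_bound_ge1 k; rewrite /step_bound; lra.
Qed.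

(** [gate u i j] and [ridge u i j] depend on blocks [j - 1] and [j] only. *)
Definition weight i j v : R := bnorm (blk i j.-1) v + bnorm (blk i j) v.

Lemma weight_ge0 i j v : 0 <= weight i j v.
Proof. by rewrite addr_ge0 ?bnorm_ge0. Qed.

Lemma weight_ge i j v : bnorm (blk i j) v <= weight i j v.
Proof. by rewrite lerDr bnorm_ge0. Qed.

Lemma weightp_ge i j v : bnorm (blk i j) v <= weight i j.+1 v.
Proof. by rewrite lerDl bnorm_ge0. Qed.

Lemma gate_derivatives u i j v w (b := fun x => 3 / 16 - sqdist (blk i j) u x) :
  ('D_v b = fun x => - 2 * bdot (blk i j) v (x - u)) /\
  'D_w ('D_v b) = fun=> - 2 * bdot (blk i j) v w.
Proof.
have [ds _] := smooth_sqdist 1 (blk i j) u; have [db _] := smooth_bdot 1 (blk i j) v.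
have dc (r : R) (y : V) : differentiable (fun=> r) y by exact: differentiable_cst.
have dN (y : V) : differentiable (fun x => - 1 * sqdist (blk i j) u x) y.
  by apply: (@differentiableM _ _ (fun=> - 1)).
have -> : b = fun x => 3 / 16 + - 1 * sqdist (blk i j) u x.
  by apply/funext => x; rewrite mulN1r.
have E : 'D_v (fun x => 3 / 16 + - 1 * sqdist (blk i j) u x) = fun x => - 2 * bdot (blk i j) v (x - u).
  apply/funext => x; rewrite (congr1 (@^~ x) (derive_funD v (dc _) dN)) derive_cst.
  rewrite (congr1 (@^~ x) (derive_fun_scale v (fun=> erefl) ds)).
  rewrite (congr1 (@^~ x) (derive_sqdist (blk i j) u v)); ring.
split=> //; rewrite E.
have -> : (fun x => - 2 * bdot (blk i j) v (x - u)) = fun x => - 1 * 'D_v (sqdist (blk i j) u) x.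
  by apply/funext => x; rewrite (congr1 (@^~ x) (derive_sqdist (blk i j) u v)); ring.
have [_ /(_ v)[dd _]] := smooth_sqdist 2 (blk i j) u.
rewrite (derive_fun_scale w (fun=> erefl) dd); apply/funext => x.
rewrite (congr1 (@^~ x) (derive2_sqdist (blk i j) u v w)); ring.
Qed.

Definition gate_bound k : R := k`!%:R * 2 ^+ k * step_bound k.
Definition ridge_bound k : R := k`!%:R * (5 * step_bound k).

Lemma gate_bound_ge1 k : 1 <= gate_bound k.
Proof.
by rewrite /gate_bound !mulr_ege1 ?exprn_ege1 ?ler1n ?fact_gt0// step_bound_ge1.
Qed.

(** The chain rule through the quadratic [3 / 16 - sqdist]. The constant [c] has to
    dominate [2 * bnorm (x - u)], so that the bound is uniform in [x] only where the
    gate is not closed. *)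
Lemma dirder_gate_bound u i j x (c a : R) vs : (size vs <= N)%N ->
  2 <= c -> 2 * bnorm (blk i j) (x - u) <= c ->
  (forall k, (k <= size vs)%N -> `|T k.+1 (3 / 16 - sqdist (blk i j) u x)| <= a) ->
  `|dirder (gate u i j.+1) vs x|
    <= (size vs)`!%:R * c ^+ size vs * a * \prod_(v <- vs) weight i j.+1 v.
Proof.
move=> sv c2 xc Ta; have [c0 c1] : 0 <= c /\ 1 <= c by split; lra.
have n2 : `|- 2 : R| = 2 by rewrite normrN ger0_norm.
have W := weightp_ge i j; have B0 v := bnorm_ge0 (blk i j) v.
apply: (@dirder_comp_quadratic _ _ (weight i j.+1) x (weight_ge0 i j.+1) c a (fun k => T k.+1)
  (fun x => 3 / 16 - sqdist (blk i j) u x) (fun v w => - 2 * bdot (blk i j) v w) 0 N) => //.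
- under eq_fun do rewrite -mulN1r.
  apply: smoothD; first exact: smooth_cst.
  by apply: smoothM; [exact: smooth_cst|exact: smooth_sqdist].
- by move=> v w; have [_ ->] := gate_derivatives u i j v w.
- move=> v w; rewrite normrM n2 -[leRHS]mulrA ler_pM//.
  by apply: le_trans (bdot_le _ _ _) _; rewrite ler_pM.
- move=> v; have [/(congr1 (@^~ x)) -> _] := gate_derivatives u i j v 0.
  rewrite /= normrM n2.
  have := bdot_le (blk i j) v (x - u); have := B0 (x - u); have := W v; have := B0 v; nra.
Qed.

(** Where the gate is closed the step vanishes with all its derivatives, so the
    previous bound holds with [a = 0]. *)
Lemma dirder_gate_closed u i j x vs : (size vs <= N)%N -> ~~ seen u i j x ->
  dirder (gate u i j.+1) vs x = 0.
Proof.
rewrite /seen -leNgt => sv far; apply/eqP; rewrite -normr_le0.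
have B0 := bnorm_ge0 (blk i j) (x - u).
have := @dirder_gate_bound u i j x (2 + 2 * bnorm (blk i j) (x - u)) 0 vs sv.
rewrite mulr0 mul0r; apply; [lra|lra|].
by move=> k _; rewrite T_eq0 ?normr0//; lra.
Qed.

Lemma gate_bounded u i j x k : (k <= N)%N -> bounded_at (weight i j) x k (gate_bound k) (gate u i j).
Proof.
move=> kN vs sv; case: j => [|j].
  rewrite dirder_cst; case: vs sv => [|v vs] _.
    by rewrite big_nil mulr1 normr1 gate_bound_ge1.
  by rewrite normr0 mulr_ge0 ?prodr_ge0// => *; rewrite ?weight_ge0// (le_trans ler01)// gate_bound_ge1.
have sN : (size vs <= N)%N by exact: leq_trans kN.
have P0 : 0 <= \prod_(v <- vs) weight i j.+1 v by apply: prodr_ge0 => *; exact: weight_ge0.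
have [sn|sn] := boolP (seen u i j x); last first.
  by rewrite dirder_gate_closed// normr0 mulr_ge0// (le_trans ler01)// gate_bound_ge1.
have b1 : 2 * bnorm (blk i j) (x - u) <= 2.
  have := bnorm_ge0 (blk i j) (x - u); move: sn; rewrite /seen /sqdist -sqr_bnorm; nra.
apply: le_trans (dirder_gate_bound (a := step_bound k) sN (lexx _) b1 _) _.
  move=> l lv; apply: le_trans (T_bound _ _) _; first exact: leq_trans sN.
  by apply: step_bound_le; exact: leq_trans sv.
rewrite ler_wpM2r// /gate_bound ler_wpM2r//; first by apply: le_trans ler01 (step_bound_ge1 _).
by rewrite ler_pM ?exprn_ge0// ?ler_nat ?leq_fact// ler_weXn2l// ler1n.
Qed.

Lemma ridge_bounded u i j x k : bnorm (blk i j) u <= 1 -> (k <= N)%N ->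
  bounded_at (weight i j) x k (ridge_bound k) (ridge u i j).
Proof.
move=> u1 kN vs sv; have sN : (size vs <= N)%N by exact: leq_trans kN.
have W := weight_ge i j; have B0 v := bnorm_ge0 (blk i j) v; have B0u := B0 u.
have P0 : 0 <= \prod_(v <- vs) weight i j v by apply: prodr_ge0 => *; exact: weight_ge0.
apply: le_trans (@dirder_comp_quadratic _ _ (weight i j) x (weight_ge0 i j) 1 (5 * step_bound k)
  ridge_profile (bdot (blk i j) u) (fun v w => 0) 0 N vs _ _ _ _ _ _ _ _) _ => //.
- by move=> l t lN; apply: is_derive_ridge_profile; exact: ltnW.
- exact: smooth_bdot.
- by move=> v w; rewrite derive_bdot; exact: derive_fun_cst.
- by move=> v w; rewrite normr0 !mulr_ge0// weight_ge0.
- move=> v; rewrite (congr1 (@^~ x) (derive_bdot (blk i j) u v)) mul1r.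
  apply: le_trans (bdot_le _ _ _) _; apply: le_trans (W v).
  by rewrite ler_piMl.
- by move=> l lv; apply: ridge_profile_bound => //; lia.
rewrite expr1n mulr1 ler_wpM2r// /ridge_bound ler_wpM2r//.
  by have := step_bound_ge1 k; lra.
by rewrite ler_nat leq_fact.
Qed.

Definition link_bound k : R := 1 + 2 ^+ k * (gate_bound k * ridge_bound k).

Lemma smooth_product u i j k : (k <= N)%N -> smooth k (fun y => gate u i j y * ridge u i j y).
Proof.
by move=> kN; apply: (smooth_le kN); apply: smoothM; [exact: smooth_gate|exact: smooth_ridge].
Qed.

Lemma dirder_link u i j vs x : (size vs <= N)%N ->
  dirder (link u i j) vs x = dirder (fun x => 2^-1 * sqdist (blk i j) 0 x) vs x
    - dirder (fun x => gate u i j x * ridge u i j x) vs x.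
Proof.
move=> sN; have sp := smooth_product u i j sN.
have -> : link u i j = fun x => 2^-1 * sqdist (blk i j) 0 x + - 1 * (gate u i j x * ridge u i j x).
  by apply/funext => y; rewrite mulN1r.
rewrite dirderD.
- by rewrite (@dirderZ _ _ (- 1) _ _ _ sp) mulN1r.
- by apply: smoothM; [exact: smooth_cst|exact: smooth_sqdist].
- by apply: smoothM => //; exact: smooth_cst.
Qed.

(** The quadratic part has an unbounded gradient, but its second derivative is
    constant, whence [2 <= size vs]. *)
Lemma dirder_link_bound u i j x vs : bnorm (blk i j) u <= 1 ->
  (2 <= size vs)%N -> (size vs <= N)%N ->
  `|dirder (link u i j) vs x| <= link_bound (size vs) * \prod_(v <- vs) weight i j v.
Proof.
move=> u1 s2 sN; rewrite dirder_link//; apply: le_trans (ler_normB _ _) _.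
rewrite /link_bound mulrDl mul1r lerD//.
  apply: le_trans (dirder_half_sqdist_bound _ _ s2) _.
  by apply: ler_prod => v _; rewrite bnorm_ge0 weight_ge.
apply: (@dirderM_bound _ _ (weight i j) x (size vs)) => //.
- by apply: smooth_le sN _; exact: smooth_gate.
- by apply: smooth_le sN _; exact: smooth_ridge.
- exact: gate_bounded.
- exact: ridge_bounded.
Qed.

Lemma sum_sqr_bnorm K i v : \sum_(j < K) bnorm (blk i j) v ^+ 2 <= enorm v ^+ 2.
Proof.
rewrite enormE sqr_bnorm; under eq_bigr do rewrite sqr_bnorm.
rewrite /bdot (eq_bigr (fun j : 'I_K => \sum_c (if own c == (i, nat_of_ord j) then v 0 c * v 0 c else 0))); last first.
  by move=> j _; rewrite big_mkcond.
rewrite exchange_big /=; apply: ler_sum => c _.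
have v0 : 0 <= v 0 c * v 0 c by exact: sqr_ge0.
case ec : (own c) => [i' j'].
have [jK|jK] := ltnP j' K; last first.
  rewrite big1// => j _; case: ifPn => // /eqP[_ jE]; by move: (ltn_ord j); rewrite -jE ltnNge jK.
rewrite (bigD1 (Ordinal jK))//= big1 ?addr0; first by case: ifP.
move=> j /eqP jj'; case: ifPn => // /eqP[_ jE]; case: jj'; exact: val_inj.
Qed.

Lemma sum_sqr_weight K i v : \sum_(j < K) weight i j v ^+ 2 <= 6 * enorm v ^+ 2.
Proof.
have H : \sum_(j < K) bnorm (blk i j.-1) v ^+ 2 <= 2 * enorm v ^+ 2.
  case: K => [|K]; first by rewrite big_ord0 mulr_ge0// sqr_ge0.
  rewrite big_ord_recl /= mulr2n mulrDl mul1r lerD//; last exact: sum_sqr_bnorm.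
  by rewrite ler_sqr ?nnegrE ?bnorm_ge0 ?sqrtr_ge0// bnorm_le_enorm.
have -> : 6 * enorm v ^+ 2 = 2 * (2 * enorm v ^+ 2) + 2 * enorm v ^+ 2 by ring.
apply: le_trans (lerD (ler_wpM2l _ H) (ler_wpM2l _ (sum_sqr_bnorm K i v))) => //.
rewrite !mulr_sumr -big_split; apply: ler_sum => j _ /=.
have := sqr_ge0 (bnorm (blk i j.-1) v - bnorm (blk i j) v).
by rewrite /weight; nra.
Qed.

(** Two of the [k >= 2] directions pay for the sum over the chain by
    Cauchy-Schwarz, so the bound depends neither on [K] nor on the dimension. *)
Lemma dirder_chain_bound K u i x vs : (forall j, bnorm (blk i j) u <= 1) ->
  (2 <= size vs)%N -> (size vs <= N)%N -> (forall v, v \in vs -> enorm v <= 1) ->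
  `|dirder (chain K u i) vs x| <= 2 ^+ (size vs).+1 * link_bound (size vs).
Proof.
move=> u1 s2 sN v1.
have L0 : 0 <= link_bound (size vs).
  by rewrite /link_bound addr_ge0 ?mulr_ge0 ?exprn_ge0 ?step_bound_ge1// (le_trans ler01)// step_bound_ge1.
rewrite dirder_sum; last by move=> j; apply: smooth_le sN _; exact: smooth_link.
apply: le_trans (ler_norm_sum _ _ _) _.
apply: le_trans (ler_sum _ (fun (j : 'I_K) _ => dirder_link_bound x (u1 j) s2 sN)) _.
rewrite -mulr_sumr mulrC ler_wpM2r//.
case: vs s2 v1 {sN L0} => [|v [|w vs]]// _ v1.
have W2 z j : z \in [:: v, w & vs] -> 0 <= weight i j z <= 2.
  move=> /v1 z1; rewrite weight_ge0 /weight.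
  have := bnorm_le_enorm (blk i j.-1) z; have := bnorm_le_enorm (blk i j) z; lra.
have P2 j : 0 <= \prod_(z <- vs) weight i j z <= 2 ^+ size vs.
  rewrite prodr_ge0 => [|*]; last exact: weight_ge0.
  have -> : 2 ^+ size vs = \prod_(z <- vs) 2 :> R.
    by rewrite big_const_seq count_predT iter_mulr_1.
  rewrite [leLHS]big_seq [leRHS]big_seq; apply: ler_prod => z zs; apply: W2.
  by rewrite !inE zs !orbT.
apply: (@le_trans _ _ (\sum_(j < K) 2 ^+ size vs / 2 * (weight i j v ^+ 2 + weight i j w ^+ 2))).
  apply: ler_sum => j _; rewrite !big_cons mulrA mulrC -mulrA.
  have /andP[P0 P1] := P2 j; have p2 : 0 <= 2 ^+ size vs :> R by exact: exprn_ge0.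
  apply: ler_pM => //; first by rewrite mulr_ge0// weight_ge0.
  by have := sqr_ge0 (weight i j v - weight i j w); nra.
rewrite -mulr_sumr big_split /=.
have e1 z : z \in [:: v, w & vs] -> \sum_(j < K) weight i j z ^+ 2 <= 6.
  move=> /v1 z1; apply: le_trans (sum_sqr_weight K i z) _.
  by rewrite ler_piMr// exprn_ile1// sqrtr_ge0.
have := e1 v (mem_head _ _); have := e1 w; rewrite !inE eqxx orbT => /(_ isT) h1 h2.
have p2 : 0 <= 2 ^+ size vs :> R by exact: exprn_ge0.
rewrite !exprS; nra.
Qed.

(** * Information hidden behind closed gates *)

Lemma eq_sqdist (P : pred 'I_d) u u' x : (forall c, P c -> u 0 c = u' 0 c) ->
  sqdist P u x = sqdist P u' x.
Proof. by move=> uu'; apply: eq_bigr => c Pc; rewrite !mxE uu'. Qed.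

Lemma eq_link u u' i j : (forall c, own c = (i, j) \/ own c = (i, j.-1) -> u 0 c = u' 0 c) ->
  link u i j = link u' i j.
Proof.
move=> uu'; apply/funext => x; rewrite /link; congr (_ - _ * _).
  case: j uu' => //= j uu'; rewrite (@eq_sqdist _ u u')// => c /eqP cE; apply: uu'; by right.
rewrite /ridge /bdot; congr (ridge_profile 0 _).
by apply: eq_bigr => c /eqP cE; rewrite uu'//; left.
Qed.

Lemma dirder_link_closed u i j x vs : bnorm (blk i j.+1) u <= 1 -> (size vs <= N)%N ->
  ~~ seen u i j x ->
  dirder (link u i j.+1) vs x = dirder (fun x => 2^-1 * sqdist (blk i j.+1) 0 x) vs x.
Proof.
move=> u1 sN far; rewrite dirder_link// -[RHS]subr0; congr (_ - _).
apply/eqP; rewrite -normr_le0.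
apply: le_trans (@dirderM_bound _ _ (weight i j.+1) x (size vs) 0 (ridge_bound (size vs)) _ _ vs _ _ _ _ _) _ => //.
- by apply: smooth_le sN _; exact: smooth_gate.
- by apply: smooth_le sN _; exact: smooth_ridge.
- by move=> ws sw; rewrite dirder_gate_closed ?normr0 ?mul0r//; exact: leq_trans sN.
- exact: ridge_bounded.
- by rewrite mul0r mulr0 mul0r.
Qed.

(** The hidden vector of block [j + 1] enters twice: through the ridge of its own
    link, behind the gate centred in block [j], and as the centre of the gate of the
    next link. Both gates are closed to all orders at [x]. *)
Lemma dirder_chain_hidden K u u' i j x vs : (size vs <= N)%N ->
  (forall l, bnorm (blk i l) u <= 1) -> (forall l, bnorm (blk i l) u' <= 1) ->
  (forall c, own c != (i, j.+1) -> u 0 c = u' 0 c) ->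
  ~~ seen u i j x -> ~~ seen u i j.+1 x -> ~~ seen u' i j.+1 x ->
  dirder (chain K u i) vs x = dirder (chain K u' i) vs x.
Proof.
move=> sN u1 u1' uu' far far1 far1'.
have far' : ~~ seen u' i j x.
  rewrite /seen -(@eq_sqdist _ u)// => c /eqP cE; apply: uu'; rewrite cE.
  by apply/eqP => -[]; lia.
rewrite /chain !dirder_sum; try by move=> l; apply: smooth_le sN _; exact: smooth_link.
apply: eq_bigr => l _.
have [->|lj] := eqVneq (nat_of_ord l) j.+1; first by rewrite !dirder_link_closed.
have [->|lj2] := eqVneq (nat_of_ord l) j.+2; first by rewrite !dirder_link_closed.
congr (dirder _ vs x); apply: eq_link => c cE; apply: uu'.
by case: cE => ->; apply/eqP => -[]; lia.
Qed.

Lemma eq_chain K u u' i : (forall c, (own c).1 = i -> u 0 c = u' 0 c) -> chain K u i = chain K u' i.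
Proof.
move=> uu'; apply/funext => x; apply: eq_bigr => l _.
by rewrite (@eq_link u u')// => c [] cE; apply: uu'; rewrite cE.
Qed.

(** * Large gradient before the end of the chain *)

Lemma derive_link u i j w x : (0 < N)%N ->
  'D_w (link u i j) x = bdot (blk i j) w x
    - ('D_w (gate u i j) x * ridge u i j x
       + gate u i j x * (ridge_profile 1 (bdot (blk i j) u x) * bdot (blk i j) u w)).
Proof.
move=> N0; have := @dirder_link u i j [:: w] x N0 => /= ->.
rewrite (congr1 (@^~ x) (derive_half_sqdist (blk i j) w)).
have [dg _] := smooth_le N0 (smooth_gate u i j).
have [dr _] := smooth_le N0 (smooth_ridge u i j).
have [db _] := smooth_bdot 1 (blk i j) u.
rewrite (congr1 (@^~ x) (derive_funM w dg dr)).
have rE (t : R) := is_derive_ridge_profile t (leq0n N).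
rewrite -[ridge u i j]/(fun x => ridge_profile 0 (bdot (blk i j) u x)).
rewrite (congr1 (@^~ x) (derive_fun_comp w rE db)).
by rewrite (congr1 (@^~ x) (derive_bdot (blk i j) u w)).
Qed.

Lemma derive_gate u i j w x : (0 < N)%N ->
  'D_w (gate u i j.+1) x = T 2 (3 / 16 - sqdist (blk i j) u x) * (- 2 * bdot (blk i j) w (x - u)).
Proof.
move=> N0; have [/(congr1 (@^~ x)) /= <- _] := gate_derivatives u i j w w.
have TE1 (t : R) := TE t N0.
rewrite (congr1 (@^~ x) (derive_fun_comp w TE1 _))// => y.
have [db _] : smooth 1 (fun x => 3 / 16 - sqdist (blk i j) u x); last exact: db.
under eq_fun do rewrite -mulN1r.
apply: smoothD; first exact: smooth_cst.
by apply: smoothM; [exact: smooth_cst|exact: smooth_sqdist].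
Qed.

Lemma bdot_supported i j l w x : (forall c, own c != (i, j) -> w 0 c = 0) -> l != j ->
  bdot (blk i l) w x = 0.
Proof.
move=> w0 lj; apply: big1 => c /eqP cE; rewrite w0 ?mul0r// cE.
by apply/eqP => -[] /eqP; rewrite (negbTE lj).
Qed.

(** A direction inside block [j] is felt by the link [j] and by the gate of the link
    [j + 1]. The latter contributes a nonnegative multiple of the inner product with
    [x - u], because leaving the neighbourhood of [u] closes that gate. *)
Lemma derive_chain_block K u i j w x : (0 < N)%N -> (j < K)%N ->
  (forall c, own c != (i, j) -> w 0 c = 0) -> gate u i j x = 1 ->
  exists2 r, 0 <= r & 'D_w (chain K u i) x = bdot (blk i j) w x
    - ridge_profile 1 (bdot (blk i j) u x) * bdot (blk i j) u w
    + r * T 2 (3 / 16 - sqdist (blk i j) u x) * bdot (blk i j) w (x - u).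
Proof.
move=> N0 jK w0 g1.
have sl l : smooth (size [:: w]) (link u i l) by apply: smooth_le N0 _; exact: smooth_link.
have E : 'D_w (chain K u i) x = \sum_(l < K) 'D_w (link u i l) x.
  exact: (@dirder_sum _ _ _ (index_enum _) predT _ [:: w] x (fun l : 'I_K => sl l)).
have gw l : l != j.+1 -> 'D_w (gate u i l) x = 0.
  case: l => [|l] lj; first exact: derive_cst.
  by rewrite derive_gate// (@bdot_supported i j) ?mulr0// -eqSS.
have gj : gate u i j x * (ridge_profile 1 (bdot (blk i j) u x) * bdot (blk i j) u w)
  = ridge_profile 1 (bdot (blk i j) u x) * bdot (blk i j) u w by rewrite g1 mul1r.
have Ej : 'D_w (link u i j) x = bdot (blk i j) w x
    - ridge_profile 1 (bdot (blk i j) u x) * bdot (blk i j) u w.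
  by rewrite derive_link// gj gw ?mul0r ?add0r// neq_ltn leqnn.
have El l : l != j -> 'D_w (link u i l) x = - ('D_w (gate u i l) x * ridge u i l x).
  move=> lj; rewrite derive_link// [bdot _ u w]bdotC !(@bdot_supported i j l w)//.
  by rewrite !mulr0 addr0 sub0r.
rewrite E (bigD1 (Ordinal jK))//= Ej.
have [jK1|jK1] := ltnP j.+1 K.
  exists (2 * ridge u i j.+1 x); first by have /andP[? _] := ridge_range u i j.+1 x; rewrite mulr_ge0.
  congr (_ + _); rewrite (bigD1 (Ordinal jK1))/=; last by rewrite -val_eqE/= neq_ltn leqnn orbT.
  rewrite big1 ?addr0 => [|l /andP[lj lj1]]; last by rewrite El ?gw ?mul0r ?oppr0.
  rewrite El ?derive_gate//; first ring.
  by rewrite neq_ltn leqnn orbT.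
exists 0 => //; rewrite !mul0r; congr (_ + _); apply: big1 => l lj.
by rewrite El ?gw ?mul0r ?oppr0//; apply/eqP => lE; move: (ltn_ord l); rewrite lE ltnNge jK1.
Qed.

(** In the first block that is not passed, [2^-1 |y|^2 - ridge] behaves like
    [2^-1 |y - u|^2] when the inner product with [u] lies in [[-1, 2]], so moving
    along [y - u] works. Outside this interval the next gate is closed, the slope of
    the ridge is at most [1], and moving along [- u] or [u] works. *)
Lemma chain_descent K u i j x : (0 < N)%N -> (j < K)%N -> bdot (blk i j) u u = 1 ->
  (forall l, (l < j)%N -> passed u i l x) -> ~~ passed u i j x ->
  exists w, [/\ enorm w <= 1, forall c, own c != (i, j) -> w 0 c = 0
    & 4^-1 <= 'D_w (chain K u i) x].
Proof.
move=> N0 jK u1 px npx.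
have g1 : gate u i j x = 1.
  by case: j px {jK u1 npx} => // j px; apply: gate_passed; apply: px.
pose restrict v : V := \row_c if own c == (i, j) then v 0 c else 0.
have r0 v c : own c != (i, j) -> restrict v 0 c = 0 by rewrite mxE => /negbTE ->.
have rdot v z : bdot (blk i j) (restrict v) z = bdot (blk i j) v z.
  by apply: eq_bigr => c /= cE; rewrite mxE cE.
have rnorm v : enorm (restrict v) = bnorm (blk i j) v.
  rewrite enormE /bnorm /bdot; congr Num.sqrt; rewrite [RHS]big_mkcond; apply: eq_bigr => c _.
  by rewrite mxE /=; case: ifP; rewrite ?mulr0.
have D v : exists2 r, 0 <= r & 'D_(restrict v) (chain K u i) x = bdot (blk i j) v x
    - ridge_profile 1 (bdot (blk i j) u x) * bdot (blk i j) u v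
    + r * T 2 (3 / 16 - sqdist (blk i j) u x) * bdot (blk i j) v (x - u).
  have [r r0' ->] := derive_chain_block N0 jK (r0 v) g1.
  by exists r; rewrite // [bdot _ u (restrict v)]bdotC !rdot [bdot _ v u]bdotC.
have un : bnorm (blk i j) u = 1 by rewrite /bnorm u1 sqrtr1.
set a := bdot (blk i j) u x in D *.
have sq : a ^+ 2 - 2 * a + 1 <= sqdist (blk i j) u x.
  have := bdot_le (blk i j) u (x - u); rewrite un mul1r bdotBr u1 -/a => H.
  rewrite -[sqdist _ _ _]sqr_bnorm.
  have := bnorm_ge0 (blk i j) (x - u); move: H; rewrite ler_norml => /andP[]; nra.
have S0 : a < -1 \/ 2 < a -> T 2 (3 / 16 - sqdist (blk i j) u x) = 0.
  by move=> ha; apply: T_eq0; case: ha => ha; nra.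
have [a1|a1] := ltP a (-1).
  exists (restrict (- u)); split; [|exact: r0|]; first by rewrite rnorm -scaleN1r bnormZ un mulr1 normrN1.
  have [r _ ->] := D (- u); rewrite S0; last by left.
  rewrite mulr0 mul0r addr0 !bdotNr u1 bdotC bdotNr bdotC -/a.
  have := ridge_slope_range a; nra.
have [a2|a2] := ltP 2 a.
  exists (restrict u); split; [by rewrite rnorm un|exact: r0|].
  have [r _ ->] := D u; rewrite S0; last by right.
  rewrite mulr0 mul0r addr0 u1 -/a.
  have := ridge_slope_range a; nra.
set y := x - u; have yb : 4^-1 <= bnorm (blk i j) y.
  have := bnorm_ge0 (blk i j) y; move: npx; rewrite /passed -ltNge /sqdist -/y -sqr_bnorm; nra.
have y0 : 0 < bnorm (blk i j) y by lra.
exists (restrict ((bnorm (blk i j) y)^-1 *: y)); split; [|exact: r0|].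
  by rewrite rnorm bnormZ gtr0_norm ?invr_gt0// mulVf// gt_eqF.
have [r r0' ->] := D ((bnorm (blk i j) y)^-1 *: y).
rewrite ridge_slope_eq1 ?a1//; set b := (bnorm (blk i j) y)^-1.
have b0 : 0 < b by rewrite invr_gt0.
rewrite [bdot _ (b *: y) x]bdotC [bdot _ (b *: y) y]bdotC !bdotZr.
have -> : b * bdot (blk i j) x y - 1 * (b * bdot (blk i j) u y) = b * bdot (blk i j) y y.
  have -> : bdot (blk i j) y y = bdot (blk i j) x y - bdot (blk i j) u y.
    by rewrite {2}/y bdotBr (bdotC _ y x) (bdotC _ y u).
  ring.
rewrite -sqr_bnorm; have -> : b * bnorm (blk i j) y ^+ 2 = bnorm (blk i j) y.
  by rewrite expr2 mulrA mulVf ?mul1r// gt_eqF.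
by rewrite ler_wpDr// !mulr_ge0// ltW.
Qed.

End chain.

(** * Counting sign vectors *)

Section codes.
Variable d : nat.
Notation code := {ffun 'I_d -> bool}.
Implicit Types (P : pred 'I_d) (s t : code).

Definition fiber P s : {pred code} :=
  family (fun c => if P c then predT : pred bool else pred1 (s c)).

Lemma fiberP P s t : reflect (forall c, ~~ P c -> t c = s c) (t \in fiber P s).
Proof.
apply: (iffP familyP) => [h c Pc|h c].
  by have := h c; rewrite (negbTE Pc) => /eqP.
by case: ifPn => // /h/eqP.
Qed.

Lemma fiber_sym P s t : (t \in fiber P s) = (s \in fiber P t).
Proof. by apply/fiberP/fiberP => h c Pc; rewrite h. Qed.

(** Independence of the coordinates under the uniform distribution on a fiber, in the
    form of a product formula. *)
Lemma sum_fiber_prod P s (g : 'I_d -> bool -> nat) :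
  (\sum_(t in fiber P s) \prod_(c | P c) g c (t c) = \prod_(c | P c) (g c true + g c false))%N.
Proof.
pose h c b := if P c then g c b else 1%N.
transitivity (\sum_(t in fiber P s) \prod_c h c (t c))%N.
  by apply: eq_bigr => t _; rewrite big_mkcond.
rewrite -bigA_distr_big_dep [RHS]big_mkcond; apply: eq_bigr => c _.
rewrite /h; case: (P c).
  by rewrite big_bool.
by rewrite (big_pred1 (s c)).
Qed.

Lemma card_fiber P s : #|fiber P s| = (2 ^ #|P|)%N.
Proof.
have := @sum_fiber_prod P s (fun _ _ => 1%N).
under eq_bigr do rewrite big1//; rewrite sum1_card => ->.
by rewrite prod_nat_const.
Qed.

(** A set meeting each fiber in a proportion at most [1 / L] has density at most
    [1 / L]. *)
Lemma card_fiberwise P (B : {pred code}) L :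
  (forall s, #|[pred t in B | t \in fiber P s]| * L <= 2 ^ #|P|)%N ->
  (#|B| * L <= 2 ^ d)%N.
Proof.
move=> hB; rewrite -(leq_pmul2r (expn_gt0 2 #|P|)).
have E : (\sum_s #|[pred t in B | t \in fiber P s]| = #|B| * 2 ^ #|P|)%N.
  under eq_bigr do rewrite -sum1_card big_mkcond.
  rewrite exchange_big -sum_nat_const [RHS]big_mkcond /=; apply: eq_bigr => t _.
  under eq_bigr do rewrite inE/= inE.
  case: (t \in B) => /=; last by rewrite big1.
  rewrite -(card_fiber P t) -sum1_card -big_mkcond; apply: eq_bigl => s.
  by rewrite fiber_sym.
rewrite mulnAC -E big_distrl /=.
apply: leq_trans (leq_sum _ _) _; first by move=> s _; exact: hB.
by rewrite sum_nat_const card_ffun card_bool card_ord.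
Qed.

(** Sign patterns within Hamming distance [m / 4] of a given one are rare: weigh each
    agreement by [2], so that a fiber has total weight [3 ^ m], and use
    [3 ^ 8 < 2 ^ 13]. *)
Lemma card_near P s (z : 'I_d -> bool) l : #|P| = (8 * l)%N ->
  (#|[pred t in fiber P s | #|[pred c | P c && (t c != z c)]| <= 2 * l]| * 2 ^ l <= 2 ^ #|P|)%N.
Proof.
move=> cP; set A := [pred t in _ | _].
have W t : t \in A -> (2 ^ (6 * l) <= \prod_(c | P c) (if t c == z c then 2 else 1))%N.
  rewrite inE => /andP[_ tA].
  rewrite -big_mkcondr prod_nat_const leq_exp2l//.
  have : (#|[pred c | P c && (t c == z c)]| + #|[pred c | P c && (t c != z c)]| = #|P|)%N.
    by rewrite -[RHS](cardID [pred c | t c == z c]); congr addn; apply: eq_card => c; rewrite !inE// andbC.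
  rewrite [X in (_ <= X)%N](_ : _ = #|[pred c | P c && (t c == z c)]|)//.
  by move: tA; rewrite cP; lia.
have H : (#|A| * 2 ^ (6 * l) <= 3 ^ #|P|)%N.
  rewrite -sum_nat_const.
  apply: leq_trans (leq_sum _ W) _.
  have -> : (3 ^ #|P| = \sum_(t in fiber P s) \prod_(c | P c) (if t c == z c then 2 else 1))%N.
    rewrite (@sum_fiber_prod P s (fun c b => if b == z c then 2 else 1)%N).
    by rewrite (eq_bigr (fun=> 3%N)) ?prod_nat_const// => c _; case: (z c).
  rewrite [leqRHS](bigID A)/= -[leqLHS]addn0 leq_add//.
  rewrite leq_eqVlt; apply/orP; left; apply/eqP; apply: eq_bigl => t.
  by rewrite [t \in A]inE /=; case: (t \in fiber P s).
rewrite -(leq_pmul2r (expn_gt0 2 (6 * l))).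
apply: (@leq_trans (3 ^ #|P| * 2 ^ l)).
  by rewrite mulnAC leq_mul2r H orbT.
have e2 : (3 ^ 8 * 2 <= 2 ^ 8 * 2 ^ 6)%N by vm_compute.
have pow_le a b k : (a <= b -> a ^ k <= b ^ k)%N.
  by case: k => [|k ab]; [rewrite !expn0|rewrite leq_exp2r].
have H2 := pow_le _ _ l e2.
by rewrite cP (expnM 3) (expnM 2 8) (expnM 2 6) -(expnMn (3 ^ 8)) -(expnMn (2 ^ 8)).
Qed.

End codes.

Section sign_vectors.
Context {R : realType} {d : nat}.
Notation code := {ffun 'I_d -> bool}.
Variable m : nat.
Hypothesis m_gt0 : (0 < m)%N.

(** Entries [+- m^-1/2]: unit vectors on blocks of size [m]. *)
Definition sign_vector (s : code) : 'rV[R]_d :=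
  \row_c (if s c then (Num.sqrt m%:R)^-1 else - (Num.sqrt m%:R)^-1).

Lemma sign_vector_sqr s c : sign_vector s 0 c * sign_vector s 0 c = m%:R^-1.
Proof.
rewrite mxE; have -> : (m%:R^-1 : R) = (Num.sqrt m%:R)^-1 * (Num.sqrt m%:R)^-1.
  by rewrite -invfM -expr2 sqr_sqrtr.
by case: (s c); rewrite ?mulrNN.
Qed.

Lemma bdot_sign_vector (P : pred 'I_d) s : bdot P (sign_vector s) (sign_vector s) = #|P|%:R / m%:R.
Proof.
rewrite /bdot (eq_bigr (fun=> m%:R^-1)) => [|c _]; last exact: sign_vector_sqr.
by rewrite sumr_const mulrC mulr_natr.
Qed.

(** Where the sign of [x] disagrees with the code, the entry of [x] is at distance at
    least [m ^ (- 1/2)] from that of the sign vector. *)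
Lemma sqdist_sign_vector (P : pred 'I_d) (s : code) (x : 'rV[R]_d) :
  #|[pred c | P c && (s c != (0 <= x 0 c))]|%:R / m%:R <= sqdist P (sign_vector s) x.
Proof.
rewrite /sqdist /bdot -sum1_card natr_sum mulr_suml big_mkcond [leRHS]big_mkcond.
apply: ler_sum => c _; rewrite inE; case: (P c) => //=; case: ifP => [sx|_]; last exact: sqr_ge0.
rewrite mul1r -(sign_vector_sqr s c) !mxE.
have s0 : 0 <= (Num.sqrt m%:R)^-1 :> R by rewrite invr_ge0 sqrtr_ge0.
move: sx; case: (s c); case: leP => // x0 _; nra.
Qed.

Lemma card_sign_vector_near (P : pred 'I_d) s (x : 'rV[R]_d) l : #|P| = (8 * l)%N -> m = (8 * l)%N ->
  (#|[pred t in fiber P s | (sqdist P (sign_vector t) x < 4^-1)%R]| * 2 ^ l <= 2 ^ #|P|)%N.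
Proof.
move=> cP mE; apply: leq_trans (card_near s (fun c => 0 <= x 0 c) cP).
rewrite leq_mul2r; apply/orP; right; apply: subset_leq_card; apply/fintype.subsetP => t.
rewrite !inE => /andP[-> tx] /=; rewrite -(ler_nat R).
have m0 : 0 < m%:R :> R by rewrite ltr0n.
have := le_lt_trans (sqdist_sign_vector P t x) tx.
rewrite ltr_pdivrMr// {1}mE !natrM => h; lra.
Qed.

End sign_vectors.

Section runs.
Context {R : realType} {n q d : nat}.
Variables (A : algorithm R n q) (N K m : nat) (T : nat -> R -> R).
Hypothesis TE : forall j (t : R), (j <= N)%N -> is_derive t 1 (T j) (T j.+1 t).
Hypothesis T_unit : forall t, 0 <= T 1%N t <= 1.
Hypothesis T_eq0 : forall j t, t <= - 16^-1 -> T j t = 0.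
Hypothesis T_eq1 : forall t, 16^-1 <= t -> T 1%N t = 1.
Hypothesis T_bound : forall j t, (j <= N)%N -> `|T j.+1 t| <= 16 ^+ j * j`!%:R * j.+1`!%:R.
Hypothesis qN : (q <= N)%N.
Variable own : 'I_d -> 'I_n * nat.
Notation blk i j := [pred c | own c == (i, j : nat)].
Variable l : nat.
Hypothesis m_gt0 : (0 < m)%N.
Hypothesis mE : m = (8 * l)%N.
Hypothesis card_blk : forall i j, (j < K)%N -> #|blk i j| = m.
Hypothesis card_blk0 : forall i j, (K <= j)%N -> #|blk i j| = 0%N.
Variables (alpha r : R).
Notation code := {ffun 'I_d -> bool}.
Notation V := 'rV[R]_d.
Implicit Types (s : code) (xi : R) (i : 'I_n) (j t : nat).

Definition hard_instance s (i : 'I_n) (x : V) : R :=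
  alpha * chain T own K (sign_vector m s) i (r *: x).

Definition query s xi t : 'I_n := (step A (xi, run A (hard_instance s) xi t)).1.
Definition point s xi t : V := r *: iterate A (hard_instance s) xi t.
Definition visits s xi t i : nat := \sum_(t' < t) (query s xi t' == i).

(** Component [i] visited [k] times has revealed at most its first [k] hidden
    vectors, provided no query ever hit a gate of a later block by chance. *)
Definition lucky s xi t i j : bool :=
  [&& visits s xi t i <= j, j < K & seen own (sign_vector m s) i j (point s xi t)]%N.
Definition clean s xi t : bool := [forall t' : 'I_t, forall i, forall j : 'I_K, ~~ lucky s xi t' i j].

Lemma cleanP s xi t : reflect (forall t' i j, (t' < t)%N -> ~~ lucky s xi t' i j) (clean s xi t).
Proof.
apply: (iffP 'forall_forallP) => [h t' i j tt|h t' i]; last by apply/forallP => j; exact: h.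
have [jK|jK] := ltnP j K; last by rewrite /lucky (leqNgt K) in jK *; rewrite (negbTE jK) !andbF.
by have /forallP/(_ (Ordinal jK)) := h (Ordinal tt) i.
Qed.

Lemma bnorm_sign_vector s i j : bnorm (blk i j) (sign_vector m s) <= 1 :> R.
Proof.
rewrite /bnorm bdot_sign_vector; have [jK|jK] := ltnP j K.
  by rewrite card_blk// divff ?sqrtr1// pnatr_eq0 -lt0n.
by rewrite card_blk0// mul0r sqrtr0.
Qed.

Lemma pderiv_hard_instance s i x (vs : seq 'I_d) : (size vs <= N)%N ->
  pderiv (hard_instance s i) vs x = alpha * r ^+ size vs
    * dirder (chain T own K (sign_vector m s) i) [seq delta_mx 0 c | c : 'I_d <- vs] (r *: x).
Proof.
move=> sN; rewrite pderivE dirder_rescale ?size_map//.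
by apply: smooth_le sN _; exact: smooth_chain.
Qed.

(** By induction on the number of queries: a query to another component does not
    involve block [(i, j)], and at a query to component [i] the gates centred in
    blocks [j - 1] and [j] are closed, the former by cleanness of [s], the latter by
    cleanness of both codes. *)
Lemma run_hidden s s' xi t i j : (forall c, own c != (i, j) -> s c = s' c) -> (j < K)%N ->
  clean s xi t -> clean s' xi t -> (visits s xi t i <= j)%N ->
  run A (hard_instance s) xi t = run A (hard_instance s') xi t.
Proof.
move=> ss' jK /cleanP cs /cleanP cs' vt.
suff H k : (k <= t)%N -> forall k', (k' <= k)%N ->
    run A (hard_instance s) xi k' = run A (hard_instance s') xi k' by exact: (H t).
elim: k => [|k IH] kt k'; first by rewrite leqn0 => /eqP ->.
rewrite leq_eqVlt => /predU1P[->|k'k]; last by apply: IH => //; exact: ltnW.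
have {}IH k1 : (k1 <= k)%N -> run A (hard_instance s) xi k1 = run A (hard_instance s') xi k1.
  by apply: IH; exact: ltnW.
have vE : visits s xi k i = visits s' xi k i.
  by apply: eq_bigr => k1 _; rewrite /query IH// ltnW.
rewrite /= -(IH k (leqnn k)); congr [tuple of rcons _ (_, _)].
rewrite /oracle; apply/ffunP => vs; rewrite !ffunE.
set ix := step A _; have vsN : (size vs <= N)%N by apply: leq_trans qN; exact: size_bseq.
have uu' c : own c != (i, j) -> sign_vector m s 0 c = sign_vector m s' 0 c :> R.
  by move=> cij; rewrite !mxE ss'.
have [ixi|ixi] := eqVneq ix.1 i; last first.
  congr (pderiv _ vs _); apply/funext => y; rewrite /hard_instance; congr (_ * _).
  rewrite (@eq_chain _ _ _ T own K _ (sign_vector m s'))// => c ci; apply: uu'.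
  by apply/eqP => cE; move: ixi; rewrite -ci cE eqxx.
have vk : (visits s xi k i < j)%N.
  apply: leq_trans vt; rewrite /visits -addn1.
  have -> : (1 = (query s xi k == i))%N by rewrite /query -/ix ixi eqxx.
  rewrite -(big_ord_recr k (fun k' => (query s xi k' == i) : nat)) /=.
  rewrite -!(big_mkord predT (fun k' => (query s xi k' == i) : nat)).
  by rewrite (big_cat_nat (leq0n k.+1) kt)//= leq_addr.
rewrite ixi; case: j jK vt vk ss' uu' => // j jK vt vk ss' uu'.
have xE : point s xi k = point s' xi k by rewrite /point /iterate IH.
rewrite !pderiv_hard_instance//; congr (_ * _).
have pE : r *: ix.2 = point s xi k by [].
rewrite pE; apply: (@dirder_chain_hidden _ _ _ N T _ _ _ _ own K _ _ i j) => //.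
- by rewrite size_map.
- by move=> j'; exact: bnorm_sign_vector.
- by move=> j'; exact: bnorm_sign_vector.
- have := cs k i j kt; rewrite /lucky; rewrite -ltnS vk /=; rewrite ltnW //=.
- have := cs k i j.+1 kt; rewrite /lucky (ltnW vk) jK /=; exact.
- have := cs' k i j.+1 kt; rewrite /lucky -vE (ltnW vk) jK /= xE; exact.
Qed.

(** The bound on one accident: conditionally on everything outside block [(i, j)],
    the clean codes share the point at which they are tested. *)
Lemma card_first_lucky xi t i j :
  (#|[pred s | clean s xi t && lucky s xi t i j]| * 2 ^ l <= 2 ^ d)%N.
Proof.
have [jK|jK] := ltnP j K; last first.
  by rewrite eq_card0 ?mul0n// => s; rewrite !inE /lucky (ltnNge j K) jK !andbF.
apply: (@card_fiberwise _ (blk i j)) => s0.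
pose B := [pred s | clean s xi t && lucky s xi t i j].
pose D := [pred s in B | s \in fiber (blk i j) s0]; rewrite -[X in (#|X| * _ <= _)%N]/D.
have cP : #|blk i j| = (8 * l)%N by rewrite card_blk.
case: (pickP D) => [s sD|D0]; last by rewrite eq_card0 ?mul0n.
apply: leq_trans (card_sign_vector_near m_gt0 s0 (point s xi t) cP mE).
rewrite leq_mul2r; apply/orP; right; apply: subset_leq_card; apply/fintype.subsetP => s' s'D.
have /andP[/andP[cs /and3P[vs _ ss]] sf] := sD.
have /andP[/andP[cs' /and3P[vs' _ ss']] sf'] := s'D.
apply/andP; split=> //=.
have -> : point s xi t = point s' xi t.
  rewrite /point /iterate (@run_hidden s s' xi t i j)// => c cij.
  by move/fiberP: sf => ->//; move/fiberP: sf' => ->.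
exact: ss'.
Qed.

(** Union bound over the first accident. *)
Lemma card_not_clean xi t :
  (#|[pred s | ~~ clean s xi t]| * 2 ^ l <= t * (n * K) * 2 ^ d)%N.
Proof.
elim: t => [|t IH].
  rewrite mul0n eq_card0// => s; rewrite !inE; apply/negbF/cleanP => t' i j; by rewrite ltn0.
have sub : (#|[pred s | ~~ clean s xi t.+1]| <= #|[pred s | ~~ clean s xi t]|
    + \sum_(ij : 'I_n * 'I_K) #|[pred s | clean s xi t && lucky s xi t ij.1 ij.2]|)%N.
  rewrite -!sum1_card; under [X in (_ <= _ + X)%N]eq_bigr do rewrite -sum1_card big_mkcond.
  rewrite exchange_big /= [leqLHS]big_mkcond [X in (_ <= X + _)%N]big_mkcond -big_split /=.
  apply: leq_sum => s _; rewrite !inE; case: (boolP (clean s xi t)) => /= cs; last by case: ifP.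
  case: ifPn => // nc; rewrite add0n.
  have [ij lij] : exists ij : 'I_n * 'I_K, lucky s xi t ij.1 ij.2.
    apply/existsP; apply: contraR nc => /existsPn h; apply/cleanP => t' i j.
    rewrite ltnS leq_eqVlt => /predU1P[->|]; last exact: (cleanP _ _ _ cs).
    have [jK|jK] := ltnP j K; first exact: (h (i, Ordinal jK)).
    by rewrite /lucky (ltnNge j K) jK !andbF.
  by rewrite (bigD1 ij)//= inE cs lij.
apply: leq_trans (leq_mul sub (leqnn _)) _.
rewrite mulnDl mulSn mulnDl [leqRHS]addnC leq_add// big_distrl /=.
apply: (@leq_trans (\sum_(ij : 'I_n * 'I_K) 2 ^ d)).
  by apply: leq_sum => ij _; exact: card_first_lucky.
by rewrite sum_nat_const card_prod !card_ord.
Qed.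

Lemma sum_visits s xi t : (\sum_i visits s xi t i = t)%N.
Proof.
rewrite exchange_big /= (eq_bigr (fun=> 1%N)) ?sum1_card ?card_ord// => t' _.
by rewrite (bigD1 (query s xi t')) //= eqxx big1// => i /negbTE; rewrite eq_sym => ->.
Qed.

(** Each finished component has absorbed [K] of the [t] queries. *)
Lemma card_unfinished s xi t : (2 * t < n * K)%N ->
  (n <= 2 * #|[pred i | visits s xi t i < K]|)%N.
Proof.
move=> tK; have K0 : (0 < K)%N by case: (K) tK; rewrite ?muln0.
have := sum_visits s xi t.
have cE : (#|[pred i | visits s xi t i < K]| + #|[pred i | ~~ (visits s xi t i < K)]| = n)%N.
  by rewrite -[RHS]card_ord -(cardC [pred i | visits s xi t i < K])%N.
have : (#|[pred i | ~~ (visits s xi t i < K)]| * K <= \sum_i visits s xi t i)%N.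
  rewrite -sum_nat_const [leqRHS](bigID [pred i | ~~ (visits s xi t i < K)])%N /=.
  apply: leq_trans (leq_addr _ _); apply: leq_sum => i; by rewrite inE -leqNgt.
by move: tK cE; clear; nia.
Qed.

End runs.

(** * Measurability of the iterates *)

Section measurability_of_coordinates.
Context {R : realType}.

Lemma measurable_coord d (c : 'I_d) : measurable_fun setT (fun x : 'rV[R]_d => x 0 c).
Proof.
move=> _ Y mY; rewrite setTI; apply: sub_sigma_algebra; exists (0, c) => //.
by exists Y => //; rewrite setTI.
Qed.

Lemma measurable_rowP dX (X : measurableType dX) d (f : X -> 'rV[R]_d) :
  (forall c, measurable_fun setT (fun x => f x 0 c)) -> measurable_fun setT f.
Proof.
move=> mf; apply: (measurability (\bigcup_(i : 'I_1 * 'I_d) preimage_set_system setT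
  (fun M : 'rV[R]_d => M i.1 i.2) measurable)) => //.
move=> _ [_ [[i c] _ [Y mY <-]] <-]; rewrite !setTI /= (ord1 i).
by have := mf c measurableT Y mY; rewrite setTI.
Qed.

Lemma measurable_ffunP dX (X : measurableType dX) (I : finType) (f : X -> {ffun I -> R}) :
  (forall c, measurable_fun setT (fun x => f x c)) -> measurable_fun setT f.
Proof.
move=> mf; apply: (measurability (\bigcup_(i : I) preimage_set_system setT
  (fun g : {ffun I -> R} => g i) measurable)) => //.
move=> _ [_ [c _ [Y mY <-]] <-]; rewrite !setTI /=.
by have := mf c measurableT Y mY; rewrite setTI.
Qed.

Lemma measurable_rcons dX dY (X : measurableType dX) (Y : measurableType dY) t
    (f : X -> t.-tuple Y) (g : X -> Y) :
  measurable_fun setT f -> measurable_fun setT g ->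
  measurable_fun setT (fun x => [tuple of rcons (f x) (g x)]).
Proof.
move=> /measurable_fun_tnthP mf mg; apply/measurable_fun_tnthP => i.
have [it|it] := ltnP i t.
  apply: eq_measurable_fun (mf (Ordinal it)) => x _ /=.
  rewrite (tnth_nth (g x)) [RHS](tnth_nth (g x)) /= nth_rcons size_tuple it //.
apply: eq_measurable_fun mg => x _ /=.
rewrite [RHS](tnth_nth (g x)) /= nth_rcons size_tuple ltnNge it /=.
by have := ltn_ord i; rewrite ltnS => ti; rewrite eqn_leq it ti.
Qed.

(** A pointwise limit of difference quotients. *)
Lemma measurable_derive d (f : 'rV[R]_d -> R) v :
  (forall x, derivable f x v) -> measurable_fun setT f -> measurable_fun setT (fun x => 'D_v f x).
Proof.
move=> df mf.
pose h k : R := k.+1%:R^-1.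
apply: (@measurable_fun_cvg _ _ _ _ (fun k x => (h k)^-1 *: (f (h k *: v + x) - f x))).
  move=> k; apply: measurable_funM => //; apply: measurable_funB => //.
  apply: measurableT_comp => //; apply: measurable_rowP => c.
  under eq_fun do rewrite !mxE.
  by apply: measurable_funD => //; exact: measurable_coord.
move=> x _; have /cvg_dnbhs_at_right/cvg_at_rightP H := df x.
apply: (H h); split; first by move=> k; rewrite invr_gt0 ltr0n.
exact: cvg_harmonic.
Qed.

Lemma measurable_pderiv d N (f : 'rV[R]_d -> R) (s : seq 'I_d) :
  smooth N f -> measurable_fun setT f -> (size s <= N)%N -> measurable_fun setT (pderiv f s).
Proof.
move=> sf mf; elim: s => //= c s IH sN; apply: measurable_derive => [x|]; last by apply: IH; exact: ltnW.
by rewrite pderivE; apply/diff_derivable/(differentiable_dirder _ sf); rewrite size_map.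
Qed.

Lemma measurable_bdot d (P : pred 'I_d) (f g : 'rV[R]_d -> 'rV[R]_d) :
  (forall c, measurable_fun setT (fun x => f x 0 c)) ->
  (forall c, measurable_fun setT (fun x => g x 0 c)) ->
  measurable_fun setT (fun x => bdot P (f x) (g x)).
Proof.
move=> mf mg; rewrite /bdot; under eq_fun do rewrite big_mkcond.
by apply: measurable_sum => c; case: (P c) => //; exact: measurable_funM.
Qed.

Lemma measurable_enorm d : measurable_fun setT (@enorm R d).
Proof.
apply: measurableT_comp; first exact: (continuous_measurable_fun (@sqrt_continuous R)).
by apply: measurable_sum => c; apply: measurable_funX; exact: measurable_coord.
Qed.

End measurability_of_coordinates.

Section measurable_runs.
Context {R : realType} {n q d : nat}.
Variables (A : algorithm R n q) (f : 'I_n -> 'rV[R]_d -> R).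
Hypothesis mf : forall i (s : q.-bseq 'I_d), measurable_fun setT (pderiv (f i) s).

(** The queried index takes finitely many values, and on each of its level sets the
    response is a measurable function of the iterate. *)
Lemma measurable_run t : measurable_fun setT (fun xi : R => run A f xi t) /\
  measurable_fun setT (fun xi : R => iterate A f xi t).
Proof.
have mstep k : measurable_fun setT (fun xi : R => run A f xi k) ->
    measurable_fun setT (fun xi : R => ((step A (xi, run A f xi k)).1 : nat, (step A (xi, run A f xi k)).2)).
  move=> mr; apply: (measurableT_comp (@measurable_step _ _ _ A d k)).
  by apply: measurable_fun_pair.
suff mr k : measurable_fun setT (fun xi : R => run A f xi k).
  by split=> //; have /measurable_fun_pairP[_] := mstep t (mr t).
elim: k => [|k IH]; first by apply/measurable_fun_tnthP => -[].
have /measurable_fun_pairP[m1 m2] := mstep k IH.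
apply: measurable_rcons => //; apply: measurable_fun_pair; first exact: mstep.
apply: measurable_ffunP => s; under eq_fun do rewrite ffunE.
move=> _ Y mY; rewrite setTI.
have -> : (fun xi : R => pderiv (f (step A (xi, run A f xi k)).1) s (step A (xi, run A f xi k)).2) @^-1` Y
   = \bigcup_(i : 'I_n) ((fun xi : R => (step A (xi, run A f xi k)).1 : nat) @^-1` [set (i : nat)]
      `&` (fun xi : R => (step A (xi, run A f xi k)).2) @^-1` (pderiv (f i) s @^-1` Y)).
  apply/seteqP; split=> [xi Yxi|xi [i _ [/= /val_inj <-]]] //.
  by exists (step A (xi, run A f xi k)).1.
apply: fin_bigcup_measurable => // i _; apply: measurableI.
  by rewrite -[X in measurable X]setTI; exact: m1.
rewrite -[X in measurable X]setTI; apply: m2 => //.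
by rewrite -[X in measurable X]setTI; exact: mf.
Qed.

End measurable_runs.

(** * From clean runs to the complexity *)

(** Exchange of the sum over [I] with the integral: if every [x] fails at most a
    quarter of the events, then on average over [I] an event fails with probability
    at most [1 / 4]. *)
Lemma exists_likely_event {R : realType} dX (X : measurableType dX) (P : probability X R)
    (I : finType) (E : I -> set X) : (0 < #|I|)%N -> (forall i, measurable (E i)) ->
  (forall x, 4 * #|[pred i | x \notin E i]| <= #|I|)%N ->
  exists i, ((2^-1)%:E < P (E i))%E.
Proof.
move=> I0 mE cE; apply: contrapT => /forallNP noE.
have PE i : (P (E i) <= (2^-1)%:E)%E by rewrite leNgt; apply/negP; exact: noE.
have PC i : ((2^-1)%:E <= P (~` E i))%E.
  rewrite probability_setC//; move: (measure_ge0 P (E i)) (PE i).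
  by case: (P (E i)) => [e| |]//= _; rewrite -EFinB !lee_fin; lra.
have mC i : measurable (~` E i) by exact: measurableC.
have sumE : (\sum_i P (~` E i) = \int[P]_x \sum_i (\1_(~` E i) x)%:E)%E.
  rewrite ge0_integral_sum//; last by move=> i; apply/measurable_EFinP; exact: measurable_indic.
  by apply: eq_bigr => i _; rewrite integral_indic// setIT.
have le1 : (\sum_i P (~` E i) <= (#|I|%:R / 4)%:E)%E.
  rewrite sumE; apply: (@le_trans _ _ (\int[P]_x (cst (#|I|%:R / 4)%:E x))%E); last first.
    by rewrite integral_cst//= probability_setT mule1.
  apply: ge0_le_integral => //.
  - by move=> x _; apply: sume_ge0 => i _; rewrite lee_fin.
  - apply: emeasurable_sum => i; apply/measurable_EFinP; exact: measurable_indic.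
  - move=> x _; rewrite sumEFin lee_fin ler_pdivlMr// mulrC.
    have -> : \sum_i \1_(~` E i) x = #|[pred i | x \notin E i]|%:R :> R.
      rewrite -sum1_card natr_sum [RHS]big_mkcond; apply: eq_bigr => i _.
      by rewrite indicE in_setC inE; case: (x \in E i).
    by rewrite -natrM ler_nat.
have le2 : ((#|I|%:R / 2)%:E <= \sum_i P (~` E i))%E.
  have -> : ((#|I|%:R / 2)%:E = \sum_(i : I) (2^-1)%:E :> \bar R)%E.
    by rewrite sumEFin sumr_const mulr_natl.
  by apply: lee_sum => i _; exact: PC.
have := le_trans le2 le1; rewrite lee_fin => h.
have : 0 < #|I|%:R :> R by rewrite ltr0n.
lra.
Qed.

Section gradients.
Context {R : realType} {d : nat}.
Notation V := 'rV[R]_d.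

Lemma derive_gradient (f : V -> R) x v : differentiable f x ->
  'D_v f x = bdot predT v (gradient f x).
Proof. by move=> df; rewrite derive_partial//; apply: eq_bigr => c _; rewrite mxE. Qed.

Lemma differentiable_average n (f : 'I_n -> V -> R) x : (forall i y, differentiable (f i) y) ->
  differentiable (average f) x.
Proof.
move=> df; have [h _] : smooth 1 (average f); last exact: h.
by apply: smoothM; [exact: smooth_cst|apply: smooth_sum => i; split].
Qed.

Lemma derive_average n (f : 'I_n -> V -> R) x v : (forall i y, differentiable (f i) y) ->
  'D_v (average f) x = n%:R^-1 * \sum_i 'D_v (f i) x.
Proof.
move=> df; have s1 i : smooth 1 (f i) by split.
have [ds _] : smooth 1 (fun x => \sum_(i < n) f i x) by exact: smooth_sum.
rewrite (congr1 (@^~ x) (derive_fun_scale (f := average f) v (fun=> erefl) ds)).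
by have /= <- := @dirder_sum _ _ _ (index_enum _) predT _ [:: v] x s1.
Qed.

End gradients.

Section complexity_bound.
Context {R : realType} {n q d : nat}.
Variables (A : algorithm R n q) (N K m : nat) (T : nat -> R -> R).
Hypothesis TE : forall j (t : R), (j <= N)%N -> is_derive t 1 (T j) (T j.+1 t).
Hypothesis T_unit : forall t, 0 <= T 1%N t <= 1.
Hypothesis T_slope : forall t, 0 <= T 2%N t.
Hypothesis T_eq0 : forall j t, t <= - 16^-1 -> T j t = 0.
Hypothesis T_eq1 : forall t, 16^-1 <= t -> T 1%N t = 1.
Hypothesis T_bound : forall j t, (j <= N)%N -> `|T j.+1 t| <= 16 ^+ j * j`!%:R * j.+1`!%:R.
Hypothesis qN : (q <= N)%N.
Hypothesis N_gt0 : (0 < N)%N.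
Variable own : 'I_d -> 'I_n * nat.
Notation blk i j := [pred c | own c == (i, j : nat)].
Variable l : nat.
Hypothesis m_gt0 : (0 < m)%N.
Hypothesis mE : m = (8 * l)%N.
Hypothesis card_blk : forall i j, (j < K)%N -> #|blk i j| = m.
Hypothesis card_blk0 : forall i j, (K <= j)%N -> #|blk i j| = 0%N.
Variables (alpha r eps : R).
Hypothesis eps_gt0 : 0 < eps.
Hypothesis alphar : alpha * r = 8 * eps * Num.sqrt n%:R.
Notation code := {ffun 'I_d -> bool}.
Notation V := 'rV[R]_d.
Notation F := (hard_instance K m T own alpha r).
Implicit Types (s : code) (xi : R) (i : 'I_n) (j t : nat).

Lemma measurable_tower j : (j <= N)%N -> measurable_fun setT (T j).
Proof.
move=> jN; apply: continuous_measurable_fun => x; apply: differentiable_continuous.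
by apply/derivable1_diffP; have [] := TE x jN.
Qed.

Lemma smooth_hard_instance s i : smooth N (F s i).
Proof. by apply: smooth_rescale; exact: smooth_chain. Qed.

Lemma measurable_hard_instance s i : measurable_fun setT (F s i).
Proof.
have mr c : measurable_fun setT (fun x : V => (r *: x) 0 c).
  by under eq_fun do rewrite mxE; apply: measurable_funM => //; exact: measurable_coord.
have mu (u : V) c : measurable_fun setT (fun x : V => (r *: x - u) 0 c).
  under eq_fun do rewrite mxE; apply: measurable_funD => //.
have ms P u : measurable_fun setT (fun x : V => sqdist P u (r *: x)) by exact: measurable_bdot.
have mb P u : measurable_fun setT (fun x : V => bdot P u (r *: x)) by exact: measurable_bdot.
apply: measurable_funM => //; apply: measurable_sum => j.
apply: measurable_funB; first by apply: measurable_funM.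
apply: measurable_funM.
  case: {j}(nat_of_ord j) => [|j] //=.
  by apply: (measurableT_comp (measurable_tower N_gt0)); apply: measurable_funB.
by apply: measurable_funB; apply: (measurableT_comp (measurable_tower (leq0n N)));
  [apply: measurable_funD|apply: measurable_funB].
Qed.

Lemma measurable_iterate s t : measurable_fun setT (fun xi : R => iterate A (F s) xi t).
Proof.
have [] // := @measurable_run R n q d A (F s) _ t.
move=> i vs; apply: (measurable_pderiv (smooth_hard_instance s i)).
  exact: measurable_hard_instance.
by apply: leq_trans qN; exact: size_bseq.
Qed.

Lemma measurable_gradient s : measurable_fun setT (fun x => enorm (gradient (average (F s)) x)).
Proof.
apply: (measurableT_comp (@measurable_enorm R d)); apply: measurable_rowP => c.
under eq_fun do rewrite mxE.
apply: (@measurable_pderiv _ _ 1) => //.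
  apply: smoothM; first exact: smooth_cst.
  by apply: smooth_sum => i; apply: smooth_le N_gt0 _; exact: smooth_hard_instance.
by apply: measurable_funM => //; apply: measurable_sum => i; exact: measurable_hard_instance.
Qed.

Lemma derive_chain_other (u w x : V) i : (forall c, (own c).1 = i -> w 0 c = 0) ->
  'D_w (chain T own K u i) x = 0.
Proof.
move=> w0; have b0 (y : V) j : bdot (blk i j) w y = 0.
  by apply: big1 => c /eqP cE; rewrite w0 ?mul0r// cE.
have sl j : smooth (size [:: w]) (link T own u i j).
  by apply: smooth_le N_gt0 _; exact: (smooth_link TE).
have -> : 'D_w (chain T own K u i) x = \sum_(j < K) 'D_w (link T own u i j) x.
  exact: (@dirder_sum _ _ _ (index_enum _) predT _ [:: w] x (fun j : 'I_K => sl j)).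
apply: big1 => j _; rewrite (derive_link TE)// b0 [bdot _ u w]bdotC b0 !mulr0 addr0 sub0r.
case: {j}(nat_of_ord j) => [|j]; first by rewrite derive_cst mul0r oppr0.
by rewrite (derive_gate TE)// b0 !mulr0 mul0r oppr0.
Qed.

Notation clean := (clean A K m T own alpha r).
Notation visits := (visits A K m T own alpha r).

(** An unfinished component has not passed its last block, because the run is clean;
    its first unpassed block provides the direction. *)
Lemma descent_direction s xi t i : clean s xi t.+1 -> (visits s xi t i < K)%N ->
  exists w : V, [/\ enorm w <= 1, forall c, (own c).1 != i -> w 0 c = 0
    & 4^-1 <= 'D_w (chain T own K (sign_vector m s) i) (r *: iterate A (F s) xi t)].
Proof.
move=> /cleanP cs vK; set x := r *: _.
have exj : exists j, (j < K)%N && ~~ passed own (sign_vector m s) i j x.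
  exists K.-1; have K0 : (0 < K)%N by exact: leq_ltn_trans vK.
  rewrite prednK ?leqnn//=; have := cs t i K.-1 (ltnSn t).
  rewrite /lucky ltn_predL K0 -ltnS prednK// vK /=; apply: contra.
  by rewrite /passed /seen -/x; lra.
case: (ex_minnP exj) => j /andP[jK np] jmin.
have u1 : bdot (blk i j) (sign_vector m s) (sign_vector m s) = 1 :> R.
  by rewrite bdot_sign_vector// card_blk// divff// pnatr_eq0 -lt0n.
have pj k : (k < j)%N -> passed own (sign_vector m s) i k x.
  move=> kj; apply: contraT => npk; have := jmin k; rewrite npk (ltn_trans kj jK) => /(_ isT).
  by rewrite leqNgt kj.
have [w [w1 w0 wD]] := chain_descent TE T_unit T_slope T_eq0 T_eq1 N_gt0 jK u1 pj np.
by exists w; split=> // c ci; apply: w0; apply/eqP => cE; rewrite cE eqxx in ci.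
Qed.

(** The descent directions of the at least [n / 2] unfinished components are
    orthogonal, so their sum over the set [U] has norm at most [sqrt #|U|], while the
    derivative along it is at least [#|U| * alpha * r / (4 n)]. *)
Lemma gradient_clean s xi t : clean s xi t.+1 -> (2 * t < n * K)%N ->
  eps < enorm (gradient (average (F s)) (iterate A (F s) xi t)).
Proof.
move=> cs tnK; set x := iterate _ _ _ _.
have n0 : (0 < n)%N by case: (n) tnK.
have /boolp.choice[w wP] : forall i, exists w : V, (visits s xi t i < K)%N ->
    [/\ enorm w <= 1, forall c, (own c).1 != i -> w 0 c = 0
    & 4^-1 <= 'D_w (chain T own K (sign_vector m s) i) (r *: x)].
  move=> i; have [vK|vK] := ltnP (visits s xi t i) K; last by exists 0.
  by have [w wP] := descent_direction cs vK; exists w.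
pose U := [pred i | visits s xi t i < K]%N.
pose a : R := alpha * r / (4 * n%:R).
pose v : V := \sum_(i in U) w i.
have dF i y : differentiable (F s i) y.
  by have [h _] := smooth_le N_gt0 (smooth_hard_instance s i); exact: h.
have dchain i y : differentiable (chain T own K (sign_vector m s) i) y.
  by have [h _] := smooth_le N_gt0 (smooth_chain TE own K (sign_vector m s) i); exact: h.
have np : 0 < n%:R :> R by rewrite ltr0n.
have ar0 : 0 < alpha * r by rewrite alphar !mulr_gt0// sqrtr_gt0.
have Dw i : i \in U -> a <= 'D_(w i) (average (F s)) x.
  move=> iU; have [_ w0 wD] := wP i iU.
  rewrite derive_average// (bigD1 i)//= big1 ?addr0 => [|i' i'i]; last first.
    rewrite (congr1 (@^~ x) (derive_fun_rescale _ _ _ (dchain i'))).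
    rewrite derive_chain_other ?mulr0// => c ci; apply: w0; rewrite ci //.
  rewrite (congr1 (@^~ x) (derive_fun_rescale _ _ _ (dchain i))) /a invfM mulrA [leRHS]mulrC.
  by rewrite ler_pM2r ?invr_gt0// ler_pM2l.
have Dv : #|U|%:R * a <= bdot predT v (gradient (average (F s)) x).
  rewrite -derive_gradient; last exact: differentiable_average.
  rewrite deriveE; last exact: differentiable_average.
  rewrite linear_sum -sum1_card natr_sum mulr_suml; apply: ler_sum => i iU.
  by rewrite mul1r -deriveE ?Dw//; exact: differentiable_average.
have vn : bdot predT v v <= #|U|%:R.
  apply: (@le_trans _ _ (\sum_(i in U) bdot predT (w i) (w i))); last first.
    rewrite -sum1_card natr_sum; apply: ler_sum => i iU.
    have [w1 _ _] := wP i iU; rewrite -sqr_bnorm -enormE.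
    by rewrite exprn_ile1// sqrtr_ge0.
  rewrite [leRHS]exchange_big /=; apply: ler_sum => c _.
  have vc : v 0 c = \sum_(i in U) w i 0 c by rewrite /v summxE.
  have [oU|oU] := boolP ((own c).1 \in U).
    have -> : v 0 c = w (own c).1 0 c.
      rewrite vc (bigD1 _ oU)/= big1 ?addr0// => i /andP[iU io].
      by have [_ w0 _] := wP i iU; rewrite w0// eq_sym.
    by rewrite (bigD1 _ oU)/= lerDl sumr_ge0// => i _; exact: sqr_ge0.
  rewrite [v 0 c]vc big1 ?mul0r ?sumr_ge0// => i iU; first by rewrite -expr2 sqr_ge0.
  have [_ w0 _] := wP i iU; apply: w0; apply/eqP => oi; by rewrite oi iU in oU.
have := bdot_le predT v (gradient (average (F s)) x).
rewrite -[bnorm _ (gradient _ _)]enormE.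
set G := enorm _; set D := bdot _ _ _ => DG.
have G0 : 0 <= G by exact: sqrtr_ge0.
have DG2 : (#|U|%:R * a) ^+ 2 <= #|U|%:R * G ^+ 2.
  have Ua : 0 <= #|U|%:R * a by rewrite /a mulr_ge0 ?divr_ge0 ?(ltW ar0) ?mulr_ge0.
  have h1 : #|U|%:R * a <= bnorm predT v * G by apply: le_trans Dv _; apply: le_trans (ler_norm _) _; exact: DG.
  have h2 : (#|U|%:R * a) ^+ 2 <= (bnorm predT v * G) ^+ 2.
    by rewrite ler_sqr ?nnegrE// mulr_ge0// bnorm_ge0.
  apply: le_trans h2 _; rewrite exprMn sqr_bnorm.
  by apply: ler_wpM2r => //; exact: sqr_ge0.
have cU : n%:R <= 2 * #|U|%:R :> R.
  by rewrite -natrM ler_nat; apply: card_unfinished tnK.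
have Up : 0 < #|U|%:R :> R by lra.
have aE : a ^+ 2 = 4 * eps ^+ 2 / n%:R.
  rewrite /a alphar; have : Num.sqrt n%:R ^+ 2 = n%:R :> R by rewrite sqr_sqrtr.
  have : Num.sqrt n%:R != 0 :> R by rewrite gt_eqF// sqrtr_gt0.
  by set z := Num.sqrt _ => z0 <-; field.
have : #|U|%:R * a ^+ 2 <= G ^+ 2.
  by rewrite -(ler_pM2l Up) mulrA -expr2 -exprMn.
rewrite aE => h3.
have h4 : 2 * eps ^+ 2 <= #|U|%:R * (4 * eps ^+ 2 / n%:R).
  rewrite mulrA ler_pdivlMr//; have := sqr_ge0 eps; nra.
rewrite -ltr_sqr ?nnegrE ?(ltW eps_gt0)//.
have : 0 < eps ^+ 2 by rewrite exprn_gt0.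
lra.
Qed.

Lemma clean_le s xi t t' : (t <= t')%N -> clean s xi t' -> clean s xi t.
Proof.
by move=> tt' /cleanP h; apply/cleanP => k i j kt; apply: h; exact: leq_trans tt'.
Qed.

Notation success s t := [set xi : R | forall t', (t' <= t)%N ->
  eps < enorm (gradient (average (F s)) (iterate A (F s) xi t'))].

Lemma measurable_success s t : measurable (success s t).
Proof.
have -> : success s t = \bigcap_(t' in [set t' | (t' <= t)%N])
    [set xi : R | eps < enorm (gradient (average (F s)) (iterate A (F s) xi t'))].
  by apply/seteqP; split.
apply: bigcap_measurableType => t' _.
have mg : measurable_fun setT (fun xi : R => enorm (gradient (average (F s)) (iterate A (F s) xi t'))).
  exact: (measurableT_comp (measurable_gradient s) (measurable_iterate s t')).
rewrite -[X in measurable X]setTI.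
exact: (measurable_fun_ltr (measurable_cst _) mg measurableT (Y := [set true])).
Qed.

(** With [2 ^ l >= 4 (n K)^2] an accident has probability at most [1 / 4] for a
    random code, hence some code resists with probability more than [1 / 2]. *)
Lemma exists_hard_code : (0 < n * K)%N -> (4 * (n * K) ^ 2 <= 2 ^ l)%N ->
  exists s, (((n * K)%:R / 2)%:E <= complexity A (F s) eps)%E.
Proof.
move=> nK0 nKl; pose t0 := (n * K).-1./2.
have t0E : (2 * t0 < n * K)%N.
  rewrite /t0 mul2n; have := odd_double_half (n * K).-1; lia.
have card0 : (0 < #|{: code}|)%N by rewrite card_ffun card_bool expn_gt0.
have bad xi : (4 * #|[pred s | xi \notin success s t0]| <= #|{: code}|)%N.
  apply: (@leq_trans (4 * #|[pred s | ~~ clean s xi t0.+1]|)).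
    rewrite leq_mul2l /=; apply: subset_leq_card; apply/fintype.subsetP => s.
    rewrite !inE; apply: contra => cs; rewrite inE => t' t't.
    apply: gradient_clean; first exact: clean_le cs.
    by apply: leq_ltn_trans t0E; rewrite leq_mul2l.
  have := card_not_clean A TE T_unit T_eq0 T_bound qN m_gt0 mE card_blk card_blk0 alpha r xi t0.+1.
  rewrite card_ffun card_bool card_ord => h.
  rewrite -(leq_pmul2r (expn_gt0 2 l)) -mulnA; apply: (leq_trans (leq_mul (leqnn 4) h)).
  rewrite !mulnA mulnC leq_mul2l; apply/orP; right; apply: leq_trans nKl.
  rewrite -mulnA -mulnA leq_mul2l /= -mulnn leq_mul2r; apply/orP; right; lia.
have [s Ps] := exists_likely_event (uniform_prob (@ltr01 R)) card0 (fun s => measurable_success s t0) bad.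
exists s; apply: le_ereal_inf_tmp => _ [t /= Pt <-]; rewrite lee_fin ler_pdivrMr// -natrM ler_nat.
rewrite leqNgt; apply/negP => tnK.
have tt0 : (t <= t0)%N by rewrite /t0; lia.
have : (uniform_prob (@ltr01 R) (success s t0) <= uniform_prob (@ltr01 R) (success s t))%E.
  apply: le_measure; rewrite ?inE; try exact: measurable_success.
  by move=> xi /= h t' t't; apply: h; exact: leq_trans tt0.
move=> /(le_trans)/(_ Pt); rewrite leNgt => /negP; apply; exact: Ps.
Qed.

End complexity_bound.

(** * Membership in the function class *)

Section membership.
Context {R : realType} {n d : nat}.
Variables (N K m : nat) (T : nat -> R -> R).
Hypothesis TE : forall j (t : R), (j <= N)%N -> is_derive t 1 (T j) (T j.+1 t).
Hypothesis T_unit : forall t, 0 <= T 1%N t <= 1.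
Hypothesis T_eq0 : forall j t, t <= - 16^-1 -> T j t = 0.
Hypothesis T_bound : forall j t, (j <= N)%N -> `|T j.+1 t| <= 16 ^+ j * j`!%:R * j.+1`!%:R.
Variable own : 'I_d -> 'I_n * nat.
Notation blk i j := [pred c | own c == (i, j : nat)].
Hypothesis card_blk : forall i j, (#|blk i j| <= m)%N.
Variables (alpha r : R).
Hypotheses (alpha_ge0 : 0 <= alpha) (r_ge0 : 0 <= r).
Notation F := (hard_instance K m T own alpha r).

Lemma chain_ge (u x : 'rV[R]_d) i : - (5 * K%:R) <= chain T own K u i x.
Proof.
have -> : - (5 * K%:R) = \sum_(j < K) - 5 :> R.
  by rewrite sumr_const card_ord mulNrn mulr_natr.
apply: ler_sum => j _; rewrite /link.
have := bdot_ge0 (blk i j) (x - 0); rewrite -/(sqdist _ _ _).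
have := ridge_range TE T_unit own u i j x; have := gate_range T_unit own u i j x.
set g := gate _ _ _ _ _ _; set h := ridge _ _ _ _ _ _ => /andP[g0 g1] /andP[h0 h5] s0.
have : g * h <= 1 * 5 by rewrite ler_pM.
lra.
Qed.

Lemma chain0_le0 (u : 'rV[R]_d) i : chain T own K u i 0 <= 0.
Proof.
apply: sumr_le0 => j _; rewrite /link.
have -> : sqdist (blk i j) 0 (0 : 'rV[R]_d) = 0.
  by rewrite /sqdist subrr; apply: big1 => c _; rewrite mxE mul0r.
have /andP[h0 _] := ridge_range TE T_unit own u i j 0.
have /andP[g0 _] := gate_range T_unit own u i j 0.
by rewrite mulr0 sub0r oppr_le0 mulr_ge0.
Qed.

(** The average is nonpositive at the origin, where the quadratic part vanishes, and
    bounded below because each link is at least [- 5]. *)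
Lemma hard_instance_class p s Delta L : (0 < n)%N -> (0 < p < N)%N ->
  alpha * r ^+ p.+1 * (2 ^+ p.+2 * link_bound p.+1) <= L -> 5 * alpha * K%:R <= Delta ->
  finite_sum_class p Delta L (F s).
Proof.
move=> n0 /andP[p0 pN] hL hD.
have sF i : smooth N (F s i) by exact: smooth_hard_instance.
have dF i x (vs : seq 'I_d) : (size vs < N)%N -> differentiable (pderiv (F s i) vs) x.
  by move=> vsN; rewrite pderivE; apply: (differentiable_dirder _ (sF i)); rewrite size_map.
have ar0 : 0 <= alpha * r ^+ p.+1 by rewrite mulr_ge0// exprn_ge0.
have un i j : bnorm (blk i j) (sign_vector m s) <= 1 :> R.
  have [m0|m0] := posnP m.
    rewrite /bnorm /bdot big_pred0 ?sqrtr0// => c.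
    by have := card_blk i j; rewrite m0 leqn0 => /eqP/card0_eq/(_ c).
  rewrite /bnorm bdot_sign_vector// -[leRHS]sqrtr1 ler_sqrt//.
  by rewrite ler_pdivrMr ?ltr0n// mul1r ler_nat; exact: card_blk.
split.
- move=> i; split; first by move=> vs x vsp; apply: dF; exact: ltn_trans pN.
  by move=> vs vsp x; apply: differentiable_continuous; apply: dF; rewrite vsp.
- move=> i; apply: opnorm_lipschitz; first exact: smooth_le (sF i).
    apply: le_trans hL; rewrite mulr_ge0// mulr_ge0 ?exprn_ge0//.
    rewrite /link_bound addr_ge0// mulr_ge0 ?exprn_ge0//.
    by rewrite mulr_ge0 ?mulr_ge0 ?exprn_ge0// (le_trans ler01)// step_bound_ge1.
  move=> vs x svs v1; rewrite dirder_rescale; last by apply: smooth_le (smooth_chain TE own K _ i); rewrite svs.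
  rewrite svs normrM (ger0_norm ar0); apply: le_trans hL; rewrite ler_wpM2l// -svs.
  by apply: (dirder_chain_bound TE T_unit T_eq0 T_bound) => //; rewrite svs.
have np : 0 < n%:R :> R by rewrite ltr0n.
have avg_ge x : - (5 * alpha * K%:R) <= average (F s) x.
  have E (z : R) : n%:R * z = \sum_(i < n) z by rewrite sumr_const card_ord mulr_natl.
  rewrite /average ler_pdivlMl// E.
  apply: ler_sum => i _; have := chain_ge (sign_vector m s) (r *: x) i.
  by move=> /(ler_wpM2l alpha_ge0); rewrite /hard_instance; lra.
have avg0 : average (F s) 0 <= 0.
  rewrite /average mulr_ge0_le0 ?invr_ge0 ?ler0n//; apply: sumr_le0 => i _.
  by rewrite /hard_instance scaler0 mulr_ge0_le0// chain0_le0.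
apply: (@le_trans _ _ (0%:E - (- (5 * alpha * K%:R))%:E)%E); last by rewrite -EFinB lee_fin; lra.
apply: leeB; first by rewrite lee_fin.
by apply: le_ereal_inf_tmp => _ [x _ <-]; rewrite lee_fin.
Qed.

End membership.

(** * Constants *)

Section constants.
Context {R : realType}.
Implicit Types (p : nat).

(** The bound is a constant to the power [p] times [p! ^ 6], up to a constant factor.
    Since [p log p] vanishes for [p = 1], the exponential factor is absorbed by the
    additive [a] in that case, and by [p log 2 <= p log p] in the others. *)
Lemma chain_bound_growth : exists2 a : R, 0 <= a & forall p, (0 < p)%N ->
  2 ^+ p.+2 * link_bound p.+1 <= expR (a * p%:R * ln p%:R + a).
Proof.
pose D0 := (20 * 2048) : R; pose D1 := (2048 * 16 * 36) : R.
have l2 : 0 < ln 2 :> R by rewrite ln_gt0// ltr1n.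
have D01 : 1 <= D0 by rewrite /D0; lra.
have D11 : 1 <= D1 by rewrite /D1; lra.
pose a := ln D0 + ln D1 + ln D1 / ln 2 + 6.
have lD0 := ln_ge0 D01; have lD1 := ln_ge0 D11.
have lD12 : 0 <= ln D1 / ln 2 by rewrite divr_ge0// ltW.
have a0 : 0 <= a by rewrite /a; lra.
exists a => // p p0.
have pp : 0 < p%:R :> R by rewrite ltr0n.
have lp : 0 <= ln p%:R :> R by rewrite ln_ge0// ler1n.
have f1 k : 1 <= k`!%:R :> R by rewrite ler1n fact_gt0.
have B1 : 2 ^+ p.+2 * link_bound p.+1 <= 20 * 2048 ^+ p.+1 * p.+1`!%:R ^+ 4 * p.+2`!%:R ^+ 2 :> R.
  rewrite /link_bound /gate_bound /ridge_bound /step_bound.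
  move: (f1 p.+1) (f1 p.+2); set f := _`!%:R; set g := _`!%:R => f1' g1'.
  have -> : 16 ^+ p.+1 = (2 ^+ p.+1) ^+ 4 :> R by rewrite exprAC; congr (_ ^+ _); lra.
  have -> : 2048 ^+ p.+1 = (2 ^+ p.+1) ^+ 11 :> R by rewrite exprAC; congr (_ ^+ _); lra.
  rewrite exprS; have : 1 <= 2 ^+ p.+1 :> R by rewrite exprn_ege1// ler1n.
  move: (2 ^+ p.+1) => b b1.
  have c1 : 1 <= b ^+ 10 * f ^+ 4 * g ^+ 2 by rewrite !mulr_ege1 ?exprn_ege1.
  have := ler_wpM2l (le_trans ler01 b1) c1.
  rewrite mulr1; set c := b * (b ^+ 10 * f ^+ 4 * g ^+ 2) => bc.
  have -> : 2 * b * (1 + b * (f * b * (b ^+ 4 * f * g) * (f * (5 * (b ^+ 4 * f * g))))) = 2 * b + 10 * c.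
    by rewrite /c; ring.
  have -> : 20 * b ^+ 11 * f ^+ 4 * g ^+ 2 = 20 * c by rewrite /c; ring.
  by lra.
have B2 (u M : R) : 0 <= u -> 0 <= M ->
    u * M ^+ p.+1 * p.+1`!%:R ^+ 4 * p.+2`!%:R ^+ 2 <= u * M * (M * 16 * 36) ^+ p * p`!%:R ^+ 6.
  move=> u0 M0.
  have h1 : p.+1`!%:R <= 2 ^+ p * p`!%:R :> R.
    by rewrite -natrX -natrM ler_nat factS leq_mul2r ltn_expl// orbT.
  have h2 : p.+2`!%:R <= 6 ^+ p * p`!%:R :> R.
    rewrite -natrX -natrM ler_nat 2!factS mulnA leq_mul2r; apply/orP; right.
    case: p p0 {pp lp B1 h1} => // p _; elim: p => // p IH.
    by rewrite expnS; apply: leq_trans (leq_mul (leqnn 6) IH); nia.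
  have e1 : p.+1`!%:R ^+ 4 <= (2 ^+ p * p`!%:R) ^+ 4 :> R.
    by rewrite lerXn2r ?nnegrE ?mulr_ge0 ?exprn_ge0 ?ler0n.
  have e2 : p.+2`!%:R ^+ 2 <= (6 ^+ p * p`!%:R) ^+ 2 :> R.
    by rewrite lerXn2r ?nnegrE ?mulr_ge0 ?exprn_ge0 ?ler0n.
  apply: (@le_trans _ _ (u * M ^+ p.+1 * (2 ^+ p * p`!%:R) ^+ 4 * (6 ^+ p * p`!%:R) ^+ 2)).
    by rewrite ler_pM ?mulr_ge0 ?exprn_ge0 ?ler0n// ler_wpM2l ?mulr_ge0 ?exprn_ge0.
  have -> : (M * 16 * 36) ^+ p = M ^+ p * (2 ^+ p) ^+ 4 * (6 ^+ p) ^+ 2 :> R.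
    rewrite !exprMn (exprAC _ p 4) (exprAC _ p 2).
    by congr (_ * _ ^+ _ * _ ^+ _); rewrite -natrX.
  rewrite exprS le_eqVlt; apply/orP; left; apply/eqP; ring.
have {}B2 := B2 20 2048 (ler0n _ _) (ler0n _ _); rewrite -/D0 -/D1 in B2.
have B3 : p`!%:R <= p%:R ^+ p :> R.
  rewrite -natrX ler_nat; case: p p0 {pp lp B1 B2} => // p _.
  rewrite fact_prod -[X in (_ <= _ ^ X)%N](subn1 p.+2) -prod_nat_const_nat.
  rewrite [leqLHS]big_nat [leqRHS]big_nat; apply: leq_prod => i /andP[_]; lia.
apply: le_trans (le_trans B1 B2) _.
apply: (@le_trans _ _ (D0 * D1 ^+ p * (p%:R ^+ p) ^+ 6)).
  rewrite ler_wpM2l//; first by rewrite mulr_ge0 ?exprn_ge0 ?(le_trans ler01).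
  by rewrite lerXn2r ?nnegrE ?exprn_ge0 ?ler0n.
have D0p : 0 < D0 by exact: lt_le_trans ltr01 D01.
have D1p : 0 < D1 by exact: lt_le_trans ltr01 D11.
rewrite -(lnK D0p) -{1}(lnK D1p) -{1}(lnK pp) -!expRM_natl -!expRD ler_expR.
have hp : p%:R * ln D1 <= ln D1 + ln D1 / ln 2 * (p%:R * ln p%:R).
  have [p1|p2] := leqP p 1.
    have -> : p = 1%N by apply/eqP; rewrite eqn_leq p1 p0.
    by rewrite ln1 !mul1r mulr0 addr0.
  have l2p : ln 2 <= ln p%:R :> R by rewrite ler_ln ?posrE ?ltr0n// ler_nat.
  apply: (@le_trans _ _ (ln D1 / ln 2 * (p%:R * ln p%:R))); last by rewrite lerDr.
  rewrite [leRHS]mulrCA ler_wpM2l ?ler0n//.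
  rewrite -{1}[ln D1](divfK (lt0r_neq0 l2)) ler_wpM2l//.
have pl : 0 <= p%:R * ln p%:R :> R by rewrite mulr_ge0 ?ler0n.
rewrite -mulrA /a; move: hp pl lD0 lD1 lD12; clear.
move: (p%:R * ln D1) (p%:R * ln p%:R) (ln D0) (ln D1) (ln D1 / ln 2) => x y v w u.
by move=> *; nra.
Qed.

End constants.

(** * Choice of the parameters *)

Section exponents.
Context {R : realType}.
Variables (P e nu lam del eta : R).
Hypotheses (P1 : 1 <= P) (nu0 : 0 <= nu) (eta0 : 0 <= eta).

(** Logarithm of the chain length, up to a constant factor, when [P], [e], [nu],
    [lam], [del] and [eta] stand for [p] and the logarithms of [eps], [n], [L],
    [Delta] and [lhat p]. *)
Definition log_length : R := (lam - eta) / P + del - (P + 1) / (2 * P) * nu - (P + 1) / P * e.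

Let Pp : 0 < P. Proof. exact: lt_le_trans ltr01 P1. Qed.
Let P0 : P != 0. Proof. by rewrite gt_eqF. Qed.
Let P10 : P + 1 != 0. Proof. by rewrite gt_eqF// addr_gt0. Qed.

(** With [g = ln 8] the left-hand side is the logarithm of the chain length times
    [alpha / 8]: the two scaling conditions turn it into that of [Delta], up to the
    factor [exp (g / P)]. *)
Lemma log_length_value g : log_length + e + nu / 2 + (g + e + nu / 2 + eta - lam) / P = del + g / P.
Proof. by rewrite /log_length; field; rewrite P0. Qed.

(** The hypothesis of the theorem on [n], with the constant chosen so that the chain
    has at least one block. *)
Lemma log_length_ge g : nu <= - (2 * P / (P + 1)) * (g + eta / P) + 2 * P / (P + 1) * del
    + 2 / (P + 1) * lam - 2 * e -> g <= log_length.
Proof.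
move=> h; rewrite -subr_ge0.
have -> : log_length - g = (P + 1) / (2 * P) * (- (2 * P / (P + 1)) * (g + eta / P)
    + 2 * P / (P + 1) * del + 2 / (P + 1) * lam - 2 * e - nu).
  by rewrite /log_length; field; rewrite P0 P10.
by rewrite mulr_ge0 ?subr_ge0// divr_ge0//; move: Pp; lra.
Qed.

(** The number of blocks against the first dimension bound: they compare as soon as
    [eps ^ (p + 1) <= L]. *)
Lemma log_length_le : nu + log_length <= (2 * P - 1) / P * nu + del + 2 / P * lam - 2 * (P + 1) / P * e
  + ((P + 1) * e - lam) / P.
Proof.
rewrite -subr_ge0 [X in 0 <= X](_ : _ = (3 * P - 1) / (2 * P) * nu + eta / P); last first.
  by rewrite /log_length; field; rewrite P0.
rewrite addr_ge0//; last by rewrite divr_ge0// ltW.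
by rewrite mulr_ge0// divr_ge0//; move: P1; lra.
Qed.

(** The first dimension bound against the second: they compare as soon as
    [eps <= L]. *)
Lemma dimension_exponents : (2 * P - 1) / P * nu + del + 2 / P * lam - 2 * (P + 1) / P * e
  <= 2 * nu + del + 2 * lam - 4 * e + (2 - 2 / P) * (e - lam).
Proof.
rewrite -subr_ge0 [X in 0 <= X](_ : _ = nu / P); last by field; rewrite P0.
by rewrite divr_ge0// ltW.
Qed.

End exponents.

Section enumeration.
Variables n K m : nat.

Definition block_of (c : 'I_#|{: 'I_n * 'I_K * 'I_m}|) : 'I_n * nat :=
  ((enum_val c).1.1, nat_of_ord (enum_val c).1.2).

Lemma card_block_of i (j : nat) :
  #|[pred c | block_of c == (i, j)]| = (if j < K then m else 0)%N.
Proof.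
rewrite -sum1_card (reindex_onto enum_rank enum_val) /=; last by move=> c _; rewrite enum_valK.
rewrite (eq_bigl (fun t : 'I_n * 'I_K * 'I_m => (t.1.1 == i) && (t.1.2 == j :> nat))); last first.
  by move=> t; rewrite enum_rankK eqxx andbT /block_of !inE /= enum_rankK.
case: ltnP => jK; last first.
  by rewrite big_pred0// => -[[i' j'] k] /=; rewrite (ltn_eqF (leq_trans (ltn_ord j') jK)) andbF.
rewrite (eq_bigl (fun t : 'I_n * 'I_K * 'I_m => (t.1 == (i, Ordinal jK)) && predT t.2)); last first.
  by move=> [[i' j'] k] /=; rewrite andbT.
rewrite -(pair_big (pred1 (i, Ordinal jK)) predT (fun _ _ => 1%N)) /=.
by rewrite big_pred1_eq sum1_card card_ord.
Qed.

End enumeration.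

Section parameters.
Context {R : realType}.

Lemma expR_sqrt (x : R) : Num.sqrt (expR x) = expR (x / 2).
Proof. by rewrite -powR12_sqrt ?expR_ge0// -expRM. Qed.

Lemma natr_ge1 n : (1 <= n)%N -> 1 <= n%:R :> R.
Proof. by rewrite ler1n. Qed.

(** Blocks of length logarithmic in the number [N] of blocks: [2 ^ l] beats the
    number of possible accidents, and the total dimension exceeds [N] by a
    logarithmic factor only. *)
Lemma block_size : exists2 C : R, 1 <= C & forall N : nat, (0 < N)%N -> exists l,
  [/\ (0 < l)%N, (4 * N ^ 2 <= 2 ^ l)%N & (N * (8 * l))%:R <= C * (1 + ln N%:R) * N%:R].
Proof.
have l2 : 0 < ln 2 :> R by rewrite ln_gt0// ltr1n.
have c0 : 0 <= 16 / ln 2 :> R by rewrite divr_ge0// ltW.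
exists (32 + 16 / ln 2); first by lra.
move=> N N0; set t := trunc_log 2 N.
exists (2 * t.+2)%N; split => //.
  have := trunc_log_ltn N (ltnSn 1); rewrite -/t => Nt.
  have -> : (4 * N ^ 2 = (2 * N) ^ 2)%N by rewrite expnMn.
  have -> : (2 ^ (2 * t.+2) = (2 ^ t.+2) ^ 2)%N by rewrite -expnM mulnC.
  rewrite leq_exp2r//.
  by rewrite expnS leq_mul2l ltnW.
have tN : t%:R <= ln N%:R / ln 2 :> R.
  rewrite ler_pdivlMr// mulrC -[ln 2 * _]mulrC.
  have -> : t%:R * ln 2 = ln (2 ^+ t) :> R by rewrite lnXn// mulr_natl.
  rewrite ler_ln ?posrE ?exprn_gt0 ?ltr0n// -natrX ler_nat.
  exact: trunc_logP.
have lN : 0 <= ln N%:R :> R by rewrite ln_ge0// ler1n.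
rewrite natrM mulrC ler_wpM2r ?ler0n//.
have -> : (8 * (2 * t.+2))%:R = 16 * t%:R + 32 :> R by rewrite -addn2 !natrM natrD; lra.
have h : ln N%:R / ln 2 = (16 / ln 2) * ln N%:R / 16 :> R.
  by field; rewrite gt_eqF.
rewrite h in tN.
have := mulr_ge0 c0 lN; move: tN lN c0.
move: (16 / ln 2) (ln N%:R) => w v tN lN c0 wv.
have -> : (32 + w) * (1 + v) = 32 + 32 * v + w + w * v by ring.
by move: wv tN; move: (w * v) => z wv tN; lra.
Qed.

Lemma powR_expR_l (x y : R) : expR x `^ y = expR (x * y).
Proof. by rewrite expRM. Qed.

Lemma expR_invX (x : R) k : expR x ^- k = expR (- (k%:R * x)).
Proof. by rewrite expRN expRM_natl. Qed.

End parameters.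

Theorem theorem4p7 (R : realType) :
  exists (c lhat : nat -> R) (a c0 C : R) (K : nat -> R -> R -> R) (k : nat),
  [/\ forall p : nat, (1 <= p)%N -> 0 < c p,
      forall p : nat, (1 <= p)%N ->
        0 < lhat p <= expR (a * p%:R * ln p%:R + a),
      0 < c0
    & forall (p n q : nat) (Delta L eps : R) (A : algorithm R n q),
      (1 <= p)%N -> (1 <= n)%N -> 0 < Delta -> 0 < L -> 0 < eps ->
      n%:R <= c p * Delta `^ (2 * p%:R / p.+1%:R) * L `^ (2 / p.+1%:R)
                  * eps ^- 2 ->
      (* the constant of the dimension bound is the universal C as soon as
         eps <= min(L, L^(1/(p+1))), in particular for all small eps *)
      let Cd := if (eps <= L) && (eps ^+ p.+1 <= L) then C else K p Delta L in
      let X := n%:R `^ ((2 * p%:R - 1) / p%:R) * Delta * L `^ (2 / p%:R)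
                 * eps `^ (- (2 * p.+1%:R / p%:R)) in
      let Y := n%:R ^+ 2 * Delta * L ^+ 2 * eps ^- 4 in
      exists (d : nat) (f : 'I_n -> 'rV[R]_d -> R),
      [/\ d%:R <= softO Cd k d n eps X,
          X <= softO Cd k d n eps Y,
          finite_sum_class p Delta L f,
          forall i, times_differentiable q (f i)
        & ((c0 * ((L / lhat p) `^ p%:R^-1
                  * (Delta * n%:R `^ ((p%:R - 1) / (2 * p%:R))
                     / eps `^ (p.+1%:R / p%:R))))%:E
             <= complexity A f eps)%E]].
Proof.
have [a a0 chain_growth] := @chain_bound_growth R.
have [C C1 blocks] := @block_size R.
(* [lhat p = exp (eta p)], and [c p = exp (lnc p)] makes [log_length] at least
   [ln 512]. *)
pose eta p : R := a * p%:R * ln p%:R + a.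
pose lnc p : R := - (2 * p%:R / (p%:R + 1)) * (ln 512 + eta p / p%:R).
(* As [n >= 1], the hypothesis on [n] bounds [ln eps] by [E0]; for [eps] beyond the
   threshold, [Cbig] absorbs the factors by which the dimension bounds then fail. *)
pose E0 p Delta L : R :=
  (lnc p + 2 * p%:R / (p%:R + 1) * ln Delta + 2 / (p%:R + 1) * ln L) / 2.
pose Cbig p Delta L : R := C * (expR (((p%:R + 1) * E0 p Delta L - ln L) / p%:R)
  + expR ((2 - 2 / p%:R) * (E0 p Delta L - ln L))).
exists (fun p => expR (lnc p)), (fun p => expR (eta p)), a, 2048^-1, C, Cbig, 1%N.
split => [p _|p _||p n q Delta L eps A p1 n1 D0 L0 e0 hn Cd X Y].
- exact: expR_gt0.
- by rewrite expR_gt0 lexx.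
- by rewrite invr_gt0 (ltr0n R 2048).
set P : R := p%:R in hn X Y *; have P1 : 1 <= P by exact: natr_ge1.
have P0 : P != 0 by rewrite gt_eqF// (lt_le_trans ltr01).
have P10 : P + 1 != 0 by rewrite gt_eqF// addr_gt0// (lt_le_trans ltr01).
have eta0 : 0 <= eta p.
  by rewrite /eta addr_ge0// !mulr_ge0// ?ler0n// ln_ge0.
have pS : p.+1%:R = P + 1 by rewrite -natr1.
have n0 : 0 < n%:R :> R by rewrite ltr0n.
pose nu : R := ln n%:R; have nu0 : 0 <= nu by rewrite ln_ge0// natr_ge1.
pose e := ln eps; pose lam := ln L; pose del := ln Delta.
have nE : n%:R = expR nu by rewrite lnK.
have eE : eps = expR e by rewrite lnK.
have LE : L = expR lam by rewrite lnK.
have DE : Delta = expR del by rewrite lnK.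
have hln : nu <= lnc p + 2 * P / (P + 1) * del + 2 / (P + 1) * lam - 2 * e.
  move: hn; rewrite pS nE DE LE eE !powR_expR_l expR_invX -!expRD ler_expR; lra.
have XE : X = expR ((2 * P - 1) / P * nu + del + 2 / P * lam - 2 * (P + 1) / P * e).
  rewrite /X pS nE DE LE eE !powR_expR_l -!expRD; congr expR; ring.
have YE : Y = expR (2 * nu + del + 2 * lam - 4 * e).
  by rewrite /Y nE DE LE eE expR_invX -!expRM_natl -!expRD.
(* [n * Z] is the claimed complexity up to [2048]. One factor [512] pays for the range
   [5] of the links and for the constants [8] in [alpha] and [s8], and rounding [Z / 512] down
   to [K] and the final [n * K / 2] lose another factor [4]. *)
pose zeta := log_length P e nu lam del (eta p).
have zeta512 : ln 512 <= zeta by apply: log_length_ge.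
pose Z := expR zeta; have Z512 : 512 <= Z.
  by rewrite -ler_ln ?posrE ?expR_gt0 ?(ltr0n R 512)// expRK.
pose K := Num.trunc (Z / 512).
have Z0 : 0 <= Z / 512 by rewrite divr_ge0 ?expR_ge0 ?(ler0n R 512).
have /andP[KZ ZK] := trunc_itv Z0; rewrite -/K in KZ ZK.
have K1 : (1 <= K)%N.
  rewrite lt0n; apply/negP => /eqP K0; move: ZK; rewrite K0; lra.
have TE : (L / expR (eta p)) `^ P^-1 * (Delta * n%:R `^ ((P - 1) / (2 * P)) / eps `^ (p.+1%:R / P))
    = n%:R * Z.
  rewrite pS nE DE LE eE /Z -!expRN -!expRD !powR_expR_l -!expRN -!expRD; congr expR.
  by rewrite /zeta /log_length; field; rewrite P0.
have nK0 : (0 < n * K)%N by rewrite muln_gt0 n1.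
have [l [l0 lE dE]] := blocks (n * K)%N nK0.
pose m := (8 * l)%N; pose d := #|{: 'I_n * 'I_K * 'I_m}|.
have dnm : d = (n * K * m)%N by rewrite /d !card_prod !card_ord.
(* [s8] is the inverse of the scale [r]; its [p]-th power is
   [8 * eps * sqrt n * lhat p / L], so that both scaling conditions hold. *)
pose s8 := expR ((ln 8 + e + nu / 2 + eta p - lam) / P).
pose alpha := 8 * eps * Num.sqrt n%:R * s8.
have sqrtE : 8 * eps * Num.sqrt n%:R = expR (ln 8 + e + nu / 2).
  by rewrite nE expR_sqrt eE !expRD lnK ?posrE.
have s80 : 0 < s8 by exact: expR_gt0.
have ar : alpha * s8^-1 = 8 * eps * Num.sqrt n%:R by rewrite /alpha mulfK// gt_eqF.
(* Differentiability of order [q] serves the oracle, and of order [p + 1] the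
   Lipschitz bound. *)
have [T [TE' T_step T_eq0 T_eq1 T_bound]] := @smooth_step R (maxn q p.+1).
have T_unit t : 0 <= T 1%N t <= 1 by have [] := T_step t.
have T_slope t : 0 <= T 2%N t by have [] := T_step t.
pose own := @block_of n K m.
have card_own i j : (j < K)%N -> #|[pred c | own c == (i, j)]| = m.
  by move=> jK; rewrite card_block_of jK.
have card_own0 i j : (K <= j)%N -> #|[pred c | own c == (i, j)]| = 0%N.
  by move=> jK; rewrite card_block_of ltnNge jK.
have card_own_le i j : (#|[pred c | own c == (i, j)]| <= m)%N.
  by rewrite card_block_of; case: ifP.
have m0 : (0 < m)%N by rewrite muln_gt0.
have N0 : (0 < maxn q p.+1)%N by rewrite leq_max orbT.
have [s hs] := exists_hard_code A TE' T_unit T_slope T_eq0 T_eq1 T_bound (leq_maxl q p.+1) N0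
  m0 (erefl m) card_own card_own0 e0 ar nK0 lE.
pose Bs := 1 + ln (1 + d%:R) + ln (1 + n%:R) + ln (1 + eps^-1) : R.
have lnd0 : 0 <= ln (1 + d%:R) :> R by rewrite ln_ge0// lerDl.
have lnn0 : 0 <= ln (1 + n%:R) :> R by rewrite ln_ge0// lerDl.
have lne0 : 0 <= ln (1 + eps^-1) by rewrite ln_ge0// lerDl invr_ge0 ltW.
have nKZ : (n * K)%:R <= n%:R * Z.
  by rewrite natrM ler_wpM2l//; move: KZ Z512; clear; lra.
have dC : d%:R <= C * Bs * (n%:R * Z).
  rewrite dnm (le_trans dE)//; apply: ler_pM => //.
  - by rewrite mulr_ge0 ?addr_ge0 ?ln_ge0 ?natr_ge1// (le_trans ler01).
  - rewrite ler_wpM2l ?(le_trans ler01)//.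
    have : ln (n * K)%:R <= ln (1 + d%:R) :> R.
      rewrite nat1r ler_ln ?posrE ?ltr0n// ler_nat.
      by rewrite dnm ltnW// ltnS leq_pmulr.
    by move: lnn0 lne0; rewrite /Bs; clear; lra.
pose g1 := expR (((P + 1) * e - lam) / P); pose g2 := expR ((2 - 2 / P) * (e - lam)).
have P2 : 0 <= 2 - 2 / P by rewrite subr_ge0 ler_pdivrMr ?ler_pMr// (lt_le_trans ltr01).
have [Cd1 Cd2] : C * g1 <= Cd /\ C * g2 <= Cd.
  rewrite /Cd; case: ifPn => [/andP[eL epL]|_].
    have el : e <= lam by rewrite ler_ln ?posrE.
    have epl : (P + 1) * e <= lam.
      by rewrite -pS mulr_natl -lnXn// ler_ln ?posrE// exprn_gt0.
    split; rewrite ler_piMr ?(le_trans ler01)// -expR0 ler_expR.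
      by rewrite pmulr_lle0 ?invr_gt0 ?(lt_le_trans ltr01)// subr_le0.
    by rewrite mulr_ge0_le0 ?subr_le0.
  have eE0 : e <= E0 p Delta L by move: hln nu0; rewrite /E0 -/P -/del -/lam; clear; lra.
  have h1 : g1 <= expR (((P + 1) * E0 p Delta L - ln L) / P).
    by rewrite ler_expR ler_wpM2r ?invr_ge0 ?(le_trans ler01)// lerD2r ler_wpM2l ?addr_ge0 ?(le_trans ler01).
  have h2 : g2 <= expR ((2 - 2 / P) * (E0 p Delta L - ln L)).
    by rewrite ler_expR ler_wpM2l// lerD2r.
  have C0 : 0 <= C by exact: le_trans C1.
  split; rewrite /Cbig ler_wpM2l//; first by rewrite (le_trans h1)// lerDl expR_ge0.
  by rewrite (le_trans h2)// lerDr expR_ge0.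
have X0 : 0 <= X by rewrite XE expR_ge0.
have Y0 : 0 <= Y by rewrite YE expR_ge0.
have Bs1 : 1 <= Bs by rewrite /Bs -!addrA lerDl !addr_ge0.
have Cd0 : 0 <= Cd by apply: le_trans Cd1; rewrite mulr_ge0 ?expR_ge0 ?(le_trans ler01).
exists d, (hard_instance K m T own alpha s8^-1 s); split.
- rewrite /softO expr1 -/Bs (le_trans dC)//.
  have nZX : n%:R * Z <= g1 * X.
    by rewrite nE XE -!expRD ler_expR [leRHS]addrC; apply: log_length_le.
  apply: (@le_trans _ _ (C * Bs * (g1 * X))).
    by rewrite ler_wpM2l// mulr_ge0 ?(le_trans ler01).
  have -> : C * Bs * (g1 * X) = C * g1 * (Bs * X) by ring.
  by rewrite -[leRHS]mulrA ler_wpM2r// mulr_ge0// (le_trans ler01).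
- rewrite /softO expr1 -/Bs.
  have XY : X <= g2 * Y.
    by rewrite XE YE -expRD ler_expR [leRHS]addrC; apply: dimension_exponents.
  rewrite (le_trans XY)// ler_wpM2r// (@le_trans _ _ Cd)//.
    by apply: le_trans Cd2; rewrite ler_peMl// expR_ge0.
  by rewrite ler_peMr.
- apply: (hard_instance_class TE' T_unit T_eq0 T_bound card_own_le) => //.
  + by rewrite /alpha !mulr_ge0 ?sqrtr_ge0// ltW.
  + by rewrite invr_ge0 ltW.
  + by rewrite p1 leq_max leqnn orbT.
  + have -> : alpha * s8^-1 ^+ p.+1 = L / expR (eta p).
      rewrite exprS mulrA ar sqrtE exprVn /s8 -expRM_natl [p%:R * _]mulrC divfK//.
      by rewrite LE -!expRN -!expRD; congr expR; ring.
    by rewrite mulrAC ler_pdivrMr ?expR_gt0// ler_pM2l//; exact: chain_growth.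
  + have aZ : alpha * Z <= 64 * Delta.
      have -> : 64 = expR (ln 8 + ln 8) :> R by rewrite expRD lnK ?posrE// -natrM.
      rewrite /alpha sqrtE DE -!expRD ler_expR -/del.
      have := @log_length_value R P e nu lam del (eta p) P1 (ln 8); rewrite -/zeta => h.
      have : ln 8 / P <= ln 8 by rewrite ler_pdivrMr ?(lt_le_trans ltr01)// ler_peMr// ln_ge0// ler1n.
      by move: h; clear; lra.
    have : 5 * alpha * K%:R <= 5 * alpha * (Z / 512).
      by rewrite ler_wpM2l// !mulr_ge0 ?sqrtr_ge0 ?expR_ge0// ltW.
    by move: aZ D0; clear; lra.
- move=> i vs x vq; rewrite pderivE; apply: (@differentiable_dirder _ _ (maxn q p.+1)).
    exact: smooth_hard_instance.
  by rewrite size_map leq_max vq.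
- rewrite TE; apply: le_trans hs; rewrite lee_fin natrM.
  rewrite mulrCA -mulrA ler_wpM2l//.
  have K1R : 1 <= K%:R :> R by rewrite ler1n.
  by move: ZK K1R; rewrite -[K.+1%:R]natr1; clear; lra.
Qed.
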